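(* Let $\mathbb{H}$ be a complex Hilbert space and let $T\in B(\mathbb{H})$. Then for all $t\in[0,1]$, $$w^2(T)\leq \sum_{n=1}^{\infty}\frac{1}{4^n}\left(\|\widetilde{T}_{t_{n-1}}\|\,\|\widetilde{T}_{t_n}\|+\|\widetilde{T}_{t_{n-1}}^*\widetilde{T}_{t_{n-1}}+\widetilde{T}_{t_{n-1}}\widetilde{T}_{t_{n-1}}^*\|\right),$$ where $\widetilde{T}_{t_n}$ denotes the $n$th iterated $t$-Aluthge transform of $T$.
   Context: $B(\mathbb{H})$ is the algebra of bounded linear operators on $\mathbb{H}$ and $\|\cdot\|$ the operator norm. The numerical radius is $w(T)=\sup\{|\langle Tx,x\rangle|: x\in\mathbb{H},\ \|x\|=1\}$, and $w^2(T)=(w(T))^2$. For $S\in B(\mathbb{H})$, $|S|=(S^*S)^{1/2}$ and $S=U|S|$ is the polar decomposition, with $U$ the partial isometry satisfying $\ker U=\ker S$. For $t\in[0,1]$ the $t$-Aluthge transform of $S$ is $\widetilde{S}_t=|S|^{t}U|S|^{1-t}$, with the convention $|S|^0:=U^*U$. For fixed $t\in[0,1]$ the iterated $t$-Aluthge transforms of $T$ are defined by $\widetilde{T}_{t_0}=T$ and, for $n\geq1$, $\widetilde{T}_{t_n}$ is the $t$-Aluthge transform of $\widetilde{T}_{t_{n-1}}$ (the same $t$ at every step). *)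

(* Defs.v *)
From HB Require Import structures.
From mathcomp Require Import all_boot all_order all_algebra.
From mathcomp Require Export complex.
From mathcomp Require Import all_classical all_reals all_analysis.

Set Implicit Arguments.
Unset Strict Implicit.
Unset Printing Implicit Defensive.

Import Order.TTheory GRing.Theory Num.Theory.
Import numFieldNormedType.Exports.

Local Open Scope classical_set_scope.
Local Open Scope complex_scope.
Local Open Scope ring_scope.

(* [inner] is linear in its first argument and conjugate-linear in the
   second; the norm of a normed module over [R[i]] takes its values in
   [R[i]], so that [inner_norm] is an equation between complex numbers. *)
HB.mixin Record CompleteNormedModule_isHilbert (R : realType) H
    of CompleteNormedModule R[i] H := {
  inner : {dot H for (@Num.conj R[i])} ;
  inner_norm : forall x : H, inner x x = `|x| ^+ 2
}.

#[short(type="hilbertType")]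
HB.structure Definition Hilbert (R : realType) :=
  { H of CompleteNormedModule_isHilbert R H & CompleteNormedModule R[i] H }.

Section BoundedOperators.
Context {R : realType} {H : hilbertType R}.
Implicit Types (A S T U : H -> H) (s t : R).

Definition bounded_op T : Prop :=
  linear T /\ exists M : R, forall x, `|T x| <= M%:C * `|x|.

(* [sup] is 0 on the empty set and on unbounded sets: [opnorm] is meant for
   bounded operators only, and [num_radius] is 0 on the zero space. *)
Definition opnorm T : R :=
  sup [set complex.Re `|T x| | x in [set x : H | `|x| <= 1]].

Definition num_radius T : R :=
  sup [set complex.Re `|inner (T x) x| | x in [set x : H | `|x| = 1]].

(* [xget] picks the (unique) element of the given set of operators; the
   default value is used only if there is none. *)
Definition adjoint T : H -> H :=
  xget (fun=> 0)
    [set S | bounded_op S /\ forall x y, inner (T x) y = inner x (S y)].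

Definition poly_op (p : {poly R}) A : H -> H :=
  fun x => \sum_(i < size p) (p`_i)%:C *: iter i A x.

(* Continuous functional calculus: for a positive operator A, whose spectrum
   lies in [0, ||A||], f(A) is the limit in operator norm of the p_k(A) for
   real polynomials p_k converging uniformly to f on [0, ||A||]. *)
Definition is_fun_calc (f : R -> R) A (B : H -> H) : Prop :=
  bounded_op B /\
  exists p : nat -> {poly R},
    {uniform [set` `[0, opnorm A]], (fun k x => (p k).[x]) @ \oo --> f} /\
    opnorm (fun x => poly_op (p k) A x - B x) @[k --> \oo] --> (0 : R).

(* A^s for A positive and s > 0 *)
Definition op_pow A s : H -> H :=
  xget (fun=> 0) [set B | is_fun_calc (fun x => x `^ s) A B].

Definition op_abs S : H -> H := op_pow (adjoint S \o S) 2^-1.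

(* isometric on the orthogonal complement of its kernel *)
Definition partial_isometry U : Prop :=
  forall x, (forall y, U y = 0 -> inner x y = 0) -> `|U x| = `|x|.

Definition polar_part S : H -> H :=
  xget (fun=> 0)
    [set U | [/\ bounded_op U, partial_isometry U,
                 (forall x, U x = 0 <-> S x = 0)
               & S = U \o op_abs S]].

(* |S|^s, with the convention |S|^0 = U^* U *)
Definition abs_pow S s : H -> H :=
  if s == 0 then adjoint (polar_part S) \o polar_part S
  else op_pow (op_abs S) s.

Definition aluthge t S : H -> H :=
  abs_pow S t \o polar_part S \o abs_pow S (1 - t).

Definition iter_aluthge t T (n : nat) : H -> H := iter n (aluthge t) T.

End BoundedOperators.

(* Main.v *)
(* Rotating T so that <T x, x> >= 0, one gets |<T x, x>|^2 <= |(T^* + T) x / 2|^2, hence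
   4 w(T)^2 <= ||T^* T + T T^*|| + 2 w(T^2).  Let T1 be the Aluthge transform of T and
   write T^2 = Y Z with Z = |T|^t and Y = U |T|^(1-t) T1, so that Z Y = T1^2.  From
   2 Re <Y Z x, x> <= (||Y|| ||Z|| + w(Z Y)) |x|^2 and the power inequality
   w(T1^2) <= w(T1)^2 it follows that
     w(T)^2 <= (||T|| ||T1|| + ||T^* T + T T^*||) / 4 + w(T1)^2 / 4,
   and iterating gives the series, as w(T_n) <= ||T_n|| <= ||T||.
   Since T^*, |T|^t and U are only specified by their properties, their existence has to
   be established: T^* by Riesz representation, |T|^t from the spectral mapping bound
   ||q(A)|| <= max |q| on [0, ||A||] and Bernstein approximation of x^t, and U as the
   strong limit of T r_n(|T|), where x r_n(x) -> 1 for x > 0. *)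

Require Import Defs.
From mathcomp Require Import all_boot all_order all_algebra.
From mathcomp Require Import all_classical all_reals all_analysis.
From mathcomp Require Import ring lra.

Set Implicit Arguments.
Unset Strict Implicit.
Unset Printing Implicit Defensive.

Import Order.TTheory GRing.Theory Num.Theory.
Import numFieldNormedType.Exports.

Local Open Scope classical_set_scope.
Local Open Scope complex_scope.
Local Open Scope ring_scope.

(** * Real-valued norm and inner product *)

Section InnerProduct.
Context {R : realType} {H : hilbertType R}.
Implicit Types (x y z : H) (a b : R[i]) (r s : R).

(** All operators are chosen by [xget] with default value 0, so an unsuccessful choice would
    silently be the zero operator: nothing can be said about an Aluthge transform before existence
    is settled. The spectrum is never introduced; a real polynomial is split over the complex
    numbers and its factors [A - z] are bounded below directly. Moduli are removed by a rotation c
    with |c| = 1, so that estimates concern the real inner product [rip]; the phase c^2 which then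
    multiplies T^2 is put into Y. Placing T1 inside Y is what produces the product of norms, since
    ||Y|| ||Z|| <= ||T||^(1-t) ||T1|| ||T||^t and the exponents add up to 1. The endpoints t = 0 and
    t = 1 need their own argument, because |T|^0 is U^* U, the projection along ker T, and not the
    identity. *)

Definition nrm x : R := complex.Re `|x|.
Definition rip x y : R := complex.Re (inner x y).
Definition cmod a : R := complex.Re `|a|.

Lemma complex_ge0E a : 0 <= a -> a = (complex.Re a)%:C.
Proof. by case: a => u v; rewrite lecE /= => /andP[/eqP ->]. Qed.

Lemma normE x : `|x| = (nrm x)%:C.
Proof. exact/complex_ge0E/normr_ge0. Qed.

Lemma cmodE a : `|a| = (cmod a)%:C.
Proof. exact/complex_ge0E/normr_ge0. Qed.

Lemma ReD a b : complex.Re (a + b) = complex.Re a + complex.Re b.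
Proof. by case: a b => ? ? []. Qed.
Lemma ReN a : complex.Re (- a) = - complex.Re a.
Proof. by case: a. Qed.
Lemma ReMr r a : complex.Re (r%:C * a) = r * complex.Re a.
Proof. by case: a => u v /=; rewrite mul0r subr0. Qed.
Lemma ReJ a : complex.Re (a^*%C) = complex.Re a.
Proof. by case: a. Qed.

Lemma cmod_ge0 a : 0 <= cmod a.
Proof. by rewrite -ler0c -cmodE. Qed.
Lemma Re_le_cmod a : complex.Re a <= cmod a.
Proof.
by rewrite -lecR -cmodE (le_trans _ (normc_ge_Re a))// lecR ler_norm.
Qed.
Lemma norm_Re_le_cmod a : `|complex.Re a| <= cmod a.
Proof. by rewrite -lecR -cmodE normc_ge_Re. Qed.
Lemma norm_Im_le_cmod a : `|complex.Im a| <= cmod a.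
Proof.
have -> : complex.Im a = - complex.Re (a * 'i%C) by rewrite ReiNIm opprK.
rewrite normrN (le_trans (norm_Re_le_cmod _))//.
rewrite -lecR -!cmodE normrM (_ : `|'i%C| = 1) ?mulr1//.
by rewrite normc_def /= expr0n expr1n add0r sqrtr1.
Qed.
Lemma cmodM a b : cmod (a * b) = cmod a * cmod b.
Proof. by apply: complexI; rewrite rmorphM -!cmodE normrM. Qed.
Lemma cmodJ a : cmod (a^*%C) = cmod a.
Proof. by apply: complexI; rewrite -!cmodE normcJ. Qed.
Lemma cmodB a b : cmod (a - b) <= cmod a + cmod b.
Proof. by rewrite -lecR rmorphD/= -!cmodE ler_normB. Qed.
Lemma cmodr r : cmod r%:C = `|r|.
Proof.
by apply: complexI; rewrite -cmodE normc_def /= expr0n addr0 sqrtr_sqr.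
Qed.

Lemma cmod_rot a : exists2 b, cmod b = 1 & complex.Re (b * a) = cmod a.
Proof.
have [->|a0] := eqVneq a 0.
  by exists 1; rewrite ?mulr0 ?/cmod ?normr1 ?normr0.
exists (`|a| / a).
  apply: complexI; rewrite -cmodE normf_div normr_id divff//.
  by rewrite normr_eq0.
by rewrite mulfVK.
Qed.

Lemma nrm_ge0 x : 0 <= nrm x.
Proof. by rewrite -ler0c -normE. Qed.
Lemma nrm_eq0 x : nrm x = 0 -> x = 0.
Proof. by move=> h; apply/normr0_eq0; rewrite normE h. Qed.
Lemma nrm0 : nrm 0 = 0.
Proof. by rewrite /nrm normr0. Qed.
Lemma nrmN x : nrm (- x) = nrm x.
Proof. by rewrite /nrm normrN. Qed.
Lemma nrmBC x y : nrm (x - y) = nrm (y - x).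
Proof. by rewrite /nrm distrC. Qed.
Lemma nrmZ a x : nrm (a *: x) = cmod a * nrm x.
Proof. by apply: complexI; rewrite rmorphM/= -cmodE -!normE normrZ. Qed.
Lemma nrmZr r x : nrm (r%:C *: x) = `|r| * nrm x.
Proof. by rewrite nrmZ cmodr. Qed.
Lemma nrmD x y : nrm (x + y) <= nrm x + nrm y.
Proof. by rewrite -lecR rmorphD/= -!normE ler_normD. Qed.
Lemma nrm_triangle z x y : nrm (x - y) <= nrm (x - z) + nrm (z - y).
Proof. by rewrite (le_trans _ (nrmD _ _))// addrA subrK. Qed.

Lemma innerDl x y z : inner (x + y) z = inner x z + inner y z.
Proof. exact: linearDl. Qed.
Lemma innerDr x y z : inner x (y + z) = inner x y + inner x z.
Proof. exact: linearDr. Qed.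
Lemma innerNl x z : inner (- x) z = - inner x z.
Proof. exact: linearNl. Qed.
Lemma innerNr x z : inner x (- z) = - inner x z.
Proof. exact: linearNr. Qed.
Lemma innerZl a x y : inner (a *: x) y = a * inner x y.
Proof. exact: linearZl_LR. Qed.
Lemma innerZr a x y : inner x (a *: y) = a^*%C * inner x y.
Proof. exact: linearZr_LR. Qed.
Lemma innerC x y : inner x y = (inner y x)^*%C.
Proof. by rewrite hermC /= expr0 mul1r. Qed.

Lemma ripC x y : rip x y = rip y x.
Proof. by rewrite /rip innerC ReJ. Qed.
Lemma ripDl x y z : rip (x + y) z = rip x z + rip y z.
Proof. by rewrite /rip innerDl ReD. Qed.
Lemma ripDr x y z : rip x (y + z) = rip x y + rip x z.
Proof. by rewrite /rip innerDr ReD. Qed.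
Lemma ripNl x z : rip (- x) z = - rip x z.
Proof. by rewrite /rip innerNl ReN. Qed.
Lemma ripNr x z : rip x (- z) = - rip x z.
Proof. by rewrite /rip innerNr ReN. Qed.
Lemma ripZl r x y : rip (r%:C *: x) y = r * rip x y.
Proof. by rewrite /rip innerZl ReMr. Qed.
Lemma ripZr r x y : rip x (r%:C *: y) = r * rip x y.
Proof. by rewrite ripC ripZl ripC. Qed.
Definition ripE := (ripDl, ripDr, ripNl, ripNr, ripZl, ripZr).

Lemma rip_nrm x : rip x x = nrm x ^+ 2.
Proof. by rewrite /rip inner_norm normE -rmorphXn. Qed.
Lemma inner_nrm x : inner x x = (nrm x ^+ 2)%:C.
Proof. by rewrite inner_norm normE rmorphXn. Qed.

Lemma nrmD_sqr x y : nrm (x + y) ^+ 2 = nrm x ^+ 2 + 2 * rip x y + nrm y ^+ 2.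
Proof. by rewrite -!rip_nrm !ripE (ripC y x); ring. Qed.
Lemma nrmB_sqr x y : nrm (x - y) ^+ 2 = nrm x ^+ 2 - 2 * rip x y + nrm y ^+ 2.
Proof. by rewrite nrmD_sqr ripNr nrmN; ring. Qed.

(** For nonzero x and y, expand the nonnegative square of the norm of |y| x - |x| y and cancel the
    factor |x| |y|. *)
Lemma rip_le x y : rip x y <= nrm x * nrm y.
Proof.
have [y0|y0] := eqVneq (nrm y) 0.
  by rewrite y0 mulr0 (nrm_eq0 y0) ripC -(subrr 0) ripDl ripNl subrr.
have yp : 0 < nrm y by rewrite lt_neqAle eq_sym y0 nrm_ge0.
have [x0|x0] := eqVneq (nrm x) 0.
  by rewrite x0 mul0r (nrm_eq0 x0) -(subrr 0) ripDl ripNl subrr.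
have xp : 0 < nrm x by rewrite lt_neqAle eq_sym x0 nrm_ge0.
have := sqr_ge0 (nrm ((nrm y)%:C *: x - (nrm x)%:C *: y)).
rewrite nrmB_sqr !nrmZr !ripE !exprMn !real_normK ?num_real//.
have p : 0 < nrm x * nrm y by rewrite mulr_gt0.
by move: (rip x y) => r h; rewrite -(ler_pM2l p); nra.
Qed.

Lemma cmod_inner_le x y : cmod (inner x y) <= nrm x * nrm y.
Proof.
have [b b1 <-] := cmod_rot (inner x y).
rewrite -innerZl (le_trans (rip_le _ _))// nrmZ b1 mul1r//.
Qed.

Lemma norm_rip_le x y : `|rip x y| <= nrm x * nrm y.
Proof. exact: le_trans (norm_Re_le_cmod _) (cmod_inner_le _ _). Qed.

Lemma rip_inj x y : (forall z, rip x z = rip y z) -> x = y.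
Proof.
move=> h; apply/eqP; rewrite -subr_eq0; apply/eqP/nrm_eq0/eqP.
by rewrite -sqrf_eq0 -rip_nrm ripDl ripNl h subrr.
Qed.

End InnerProduct.

(** * Norm convergence of sequences of vectors *)

Section Sequences.
Context {R : realType} {H : hilbertType R}.
Implicit Types (u v : nat -> H) (x y l : H) (a : R[i]) (r : R).

Definition tends u l : Prop := nrm (u n - l) @[n --> \oo] --> (0 : R).

Lemma tends_squeeze u l (e : nat -> R) :
  (forall n, nrm (u n - l) <= e n) -> e n @[n --> \oo] --> (0 : R) -> tends u l.
Proof.
move=> ule e0; apply: (squeeze_cvgr _ (cvg_cst 0) e0).
by apply: nearW => n; rewrite nrm_ge0 ule.
Qed.

Lemma tendsD u v x y : tends u x -> tends v y -> tends (fun n => u n + v n) (x + y).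
Proof.
move=> ux vy; apply: (@tends_squeeze _ _ (fun n => nrm (u n - x) + nrm (v n - y))).
  by move=> n; rewrite opprD addrACA nrmD.
by rewrite -(addr0 0); apply: cvgD.
Qed.

Lemma tendsZ a u x : tends u x -> tends (fun n => a *: u n) (a *: x).
Proof.
move=> ux; apply: (@tends_squeeze _ _ (fun n => cmod a * nrm (u n - x))).
  by move=> n; rewrite -scalerBr nrmZ.
by rewrite -(mulr0 (cmod a)); apply: cvgMr.
Qed.

Lemma tends_nrm u x : tends u x -> nrm (u n) @[n --> \oo] --> nrm x.
Proof.
move=> ux; apply/cvgrPdist_le => e e0.
move/cvgrPdist_le : ux => /(_ e e0); apply: filterS => n.
rewrite sub0r normrN ger0_norm ?nrm_ge0// => h; rewrite distrC ler_norml.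
have := nrmD (u n - x) x; have := nrmD (x - u n) (u n).
by rewrite !subrK nrmBC => *; lra.
Qed.

Lemma tends_rip u x y : tends u x -> rip (u n) y @[n --> \oo] --> rip x y.
Proof.
move=> ux0; have ux : nrm (u n - x) * nrm y @[n --> \oo] --> (0 : R).
  by rewrite -(mul0r (nrm y)); apply: cvgMl.
apply/cvgrPdist_le => e e0.
move/cvgrPdist_le : ux => /(_ e e0); apply: filterS => n.
rewrite sub0r normrN distrC -ripNl -ripDl => h.
exact: le_trans (norm_rip_le _ _) (le_trans (ler_norm _) h).
Qed.

Lemma tends_uniq u x y : tends u x -> tends u y -> x = y.
Proof.
move=> ux uy; apply: rip_inj => z.
exact: (cvg_unique (@Rhausdorff R) (tends_rip ux) (tends_rip uy)).
Qed.

Lemma tends_cst x : tends (fun=> x) x.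
Proof. by rewrite /tends subrr nrm0; apply: cvg_cst. Qed.

Lemma cauchy_tends u :
  (forall e : R, 0 < e -> exists N, forall n m, (N <= n)%N -> (N <= m)%N ->
     nrm (u n - u m) < e) -> exists l, tends u l.
Proof.
move=> hu.
have : cauchy (u @ \oo).
  (* Balls of [H] have radii in [R[i]]; a positive radius is a real number. *)
  apply/cauchy_ballP => e e0; have [r re] : exists r : R, e = r%:C.
    by exists (complex.Re e); apply/complex_ge0E/ltW.
  have r0 : 0 < r by move: e0; rewrite re ltcR.
  have [N hN] := hu r r0.
  exists ([set u n | n in [set n | (N <= n)%N]], [set u n | n in [set n | (N <= n)%N]]).
    by split; exists N => // n Nn; exists n.
  by move=> [_ _] /= [[n Nn <-] [m Nm <-]]; rewrite -ball_normE /= normE re ltcR hN.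
move/cauchy_cvg => /cvg_ex[/= l ul]; exists l.
apply/cvgrPdist_lt => r r0; have rC : (0 : R[i]) < r%:C by rewrite ltcR.
move/cvgrPdist_lt : ul => /(_ _ rC); apply: filterS => n.
by rewrite normE ltcR nrmBC sub0r normrN ger0_norm ?nrm_ge0.
Qed.

End Sequences.

(** * Bounded operators, operator norm and numerical radius *)

Section BoundedOperators.
Context {R : realType} {H : hilbertType R}.
Implicit Types (A B S T : H -> H) (x y : H) (a : R[i]) (r M : R).

Lemma linD T : linear T -> forall x y, T (x + y) = T x + T y.
Proof. by move=> h x y; rewrite -[x in LHS]scale1r h scale1r. Qed.
Lemma lin0 T : linear T -> T 0 = 0.
Proof. by move=> h; apply: (addIr (T 0)); rewrite -linD// !add0r. Qed.
Lemma linZ T : linear T -> forall a x, T (a *: x) = a *: T x.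
Proof. by move=> h a x; rewrite -[a *: x in LHS]addr0 h lin0// addr0. Qed.
Lemma linN T : linear T -> forall x, T (- x) = - T x.
Proof. by move=> h x; rewrite -scaleN1r linZ// scaleN1r. Qed.
Lemma linB T : linear T -> forall x y, T (x - y) = T x - T y.
Proof. by move=> h x y; rewrite linD// linN. Qed.

Definition bnd M T := forall x, nrm (T x) <= M * nrm x.

Lemma bounded_opP T : bounded_op T <-> linear T /\ exists2 M, 0 <= M & bnd M T.
Proof.
split=> -[lT [M]].
  move=> hM; split=> //; exists `|M| => // x; rewrite (@le_trans _ _ (M * nrm x))//.
    by have := hM x; rewrite !normE -rmorphM lecR.
  by rewrite ler_wpM2r ?nrm_ge0 ?ler_norm.
by move=> M0 hM; split=> //; exists M => x; rewrite !normE -rmorphM lecR.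
Qed.

Lemma bounded_op_lin T : bounded_op T -> linear T.
Proof. by case. Qed.

Let unit_ball : set H := [set x : H | `|x| <= 1].

Lemma opnorm_has_sup T : bounded_op T ->
  has_sup [set complex.Re `|T x| | x in [set x : H | `|x| <= 1]].
Proof.
move=> /bounded_opP[lT [M M0 hM]]; split.
  by exists (nrm (T 0)); exists 0 => //=; rewrite normr0.
exists M => _ [x /= x1 <-]; apply: (le_trans (hM x)).
by rewrite -[leRHS]mulr1 ler_wpM2l// -lecR -normE.
Qed.

Lemma opnorm_ge0 T : 0 <= opnorm T.
Proof.
rewrite /opnorm; have [h|h] := pselect (has_sup [set complex.Re `|T x| | x in unit_ball]).
  apply: (le_trans (nrm_ge0 (T 0))); apply: sup_upper_bound => //.
  by exists 0 => //=; rewrite /unit_ball /= normr0.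
by rewrite sup_out.
Qed.

Lemma opnorm_bnd T : bounded_op T -> bnd (opnorm T) T.
Proof.
move=> bT x; have [lT _] := bT.
have [x0|x0] := eqVneq (nrm x) 0.
  by rewrite x0 (nrm_eq0 x0) lin0// nrm0 mulr0.
have xp : 0 < nrm x by rewrite lt_neqAle eq_sym x0 nrm_ge0.
rewrite -ler_pdivrMr// mulrC.
have -> : (nrm x)^-1 * nrm (T x) = nrm (T ((nrm x)^-1%:C *: x)).
  by rewrite linZ// nrmZr ger0_norm// invr_ge0 (ltW xp).
apply: sup_upper_bound; first exact: opnorm_has_sup.
exists ((nrm x)^-1%:C *: x) => //=.
by rewrite normE (lecR _ 1) nrmZr ger0_norm ?invr_ge0 ?(ltW xp)// mulVf.
Qed.

Lemma opnorm_le T M : 0 <= M -> bnd M T -> opnorm T <= M.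
Proof.
move=> M0 hM; apply: ge_sup.
  by exists (nrm (T 0)); exists 0 => //=; rewrite normr0.
move=> _ [x /= x1 <-]; apply: (le_trans (hM x)).
by rewrite -[leRHS]mulr1 ler_wpM2l// -lecR -normE.
Qed.

Lemma bounded_op_comp S T : bounded_op S -> bounded_op T -> bounded_op (S \o T).
Proof.
move=> bS bT; have [lS _] := bS; have [lT _] := bT.
apply/bounded_opP; split; first by move=> a x y /=; rewrite lT lS.
exists (opnorm S * opnorm T); first by rewrite mulr_ge0 ?opnorm_ge0.
move=> x /=; rewrite (le_trans (opnorm_bnd bS _))// -mulrA ler_wpM2l ?opnorm_ge0//.
exact: opnorm_bnd.
Qed.

Lemma bounded_opD S T : bounded_op S -> bounded_op T -> bounded_op (fun x => S x + T x).
Proof.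
move=> bS bT; have [lS _] := bS; have [lT _] := bT.
apply/bounded_opP; split; first by move=> a x y /=; rewrite lT lS scalerDr addrACA.
exists (opnorm S + opnorm T); first by rewrite addr_ge0 ?opnorm_ge0.
move=> x /=; rewrite (le_trans (nrmD _ _))// mulrDl lerD//; exact: opnorm_bnd.
Qed.

Lemma bounded_opZ a T : bounded_op T -> bounded_op (fun x => a *: T x).
Proof.
move=> bT; have [lT _] := bT.
apply/bounded_opP; split.
  by move=> b x y /=; rewrite lT scalerDr !scalerA mulrC.
exists (cmod a * opnorm T); first by rewrite mulr_ge0 ?opnorm_ge0 ?cmod_ge0.
by move=> x /=; rewrite nrmZ -mulrA ler_wpM2l ?cmod_ge0//; apply: opnorm_bnd.
Qed.

Lemma bounded_op0 : bounded_op (fun=> 0 : H).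
Proof.
apply/bounded_opP; split; first by move=> a x y; rewrite scaler0 addr0.
by exists 0 => // x; rewrite nrm0 mul0r.
Qed.

Lemma bounded_op_id : bounded_op (@id H).
Proof. by apply/bounded_opP; split => //; exists 1 => // x; rewrite mul1r. Qed.

Lemma bounded_opB S T : bounded_op S -> bounded_op T -> bounded_op (fun x => S x - T x).
Proof.
move=> bS bT; under eq_fun do rewrite -scaleN1r.
by apply: bounded_opD => //; apply: bounded_opZ.
Qed.

Lemma tends_op T u (x : H) : bounded_op T -> tends u x -> tends (T \o u) (T x).
Proof.
move=> bT ux; have [lT _] := bT.
apply: (@tends_squeeze _ _ _ _ (fun n => opnorm T * nrm (u n - x))).
  by move=> n /=; rewrite -linB//; apply: opnorm_bnd.
by rewrite -(mulr0 (opnorm T)); apply: cvgMr.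
Qed.

Lemma num_radius_ub T x : bounded_op T ->
  cmod (inner (T x) x) <= num_radius T * nrm x ^+ 2.
Proof.
move=> bT; have [lT _] := bT.
have [x0|x0] := eqVneq (nrm x) 0.
  by rewrite x0 (le_trans (cmod_inner_le _ _))// x0 expr0n/= !mulr0.
have xp : 0 < nrm x by rewrite lt_neqAle eq_sym x0 nrm_ge0.
set y := (nrm x)^-1%:C *: x.
have ny : nrm y = 1 by rewrite nrmZr ger0_norm ?invr_ge0 ?(ltW xp)// mulVf.
have -> : x = (nrm x)%:C *: y by rewrite scalerA -rmorphM divff// scale1r.
rewrite linZ// innerZl innerZr !cmodM cmodJ !cmodr nrmZr ny !ger0_norm ?nrm_ge0// mulr1.
rewrite mulrA -expr2 mulrC ler_wpM2r ?sqr_ge0//.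
apply: sup_upper_bound; last by exists y => //=; rewrite normE ny.
split; first by exists (cmod (inner (T y) y)); exists y => //=; rewrite normE ny.
exists (opnorm T) => _ [z /= z1 <-]; rewrite (le_trans (cmod_inner_le _ _))//.
have {}z1 : nrm z = 1 by apply: complexI; rewrite -normE.
by rewrite z1 mulr1 -[leRHS]mulr1 -z1 opnorm_bnd.
Qed.

Lemma num_radius_le T M : 0 <= M ->
  (forall x, nrm x = 1 -> cmod (inner (T x) x) <= M) -> num_radius T <= M.
Proof.
move=> M0 hM; rewrite /num_radius; set E := [set _ | _ in _].
(* On the zero space there is no unit vector and the supremum is 0, whence the hypothesis
   [0 <= M]. *)
have [->|/set0P E0] := eqVneq E set0; first by rewrite sup0.
apply: ge_sup => // _ [x /= x1 <-]; apply: hM.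
by apply: complexI; rewrite -normE.
Qed.

Lemma num_radius_ge0 T : 0 <= num_radius T.
Proof.
rewrite /num_radius; set E := [set _ | _ in _].
have [h|h] := pselect (has_sup E); last by rewrite sup_out.
have [[z [x x1 _]] _] := h; apply: (le_trans (cmod_ge0 (inner (T x) x))).
by apply: sup_upper_bound => //; exists x.
Qed.

End BoundedOperators.

(** * Functional calculus of a positive operator *)

Section PolynomialCalculus.
Context {R : realType} {H : hilbertType R}.
Implicit Types (A : H -> H) (x y : H) (p q : {poly R}).

(** Complex coefficients are allowed because the spectral bound below factors a real polynomial into
    ['X - z%:P] with complex z. *)
Definition cpoly_op (p : {poly R[i]}) A (x : H) : H :=
  \sum_(i < size p) p`_i *: iter i A x.

Lemma cpoly_op_widen n (p : {poly R[i]}) A x : (size p <= n)%N ->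
  cpoly_op p A x = \sum_(i < n) p`_i *: iter i A x.
Proof.
move=> pn; rewrite /cpoly_op (big_ord_widen n (fun i => p`_i *: iter i A x))//.
rewrite big_mkcond; apply: eq_bigr => i _; case: ltnP => // si.
by rewrite nth_default// scale0r.
Qed.

Lemma cpoly_opD (p q : {poly R[i]}) A x :
  cpoly_op (p + q) A x = cpoly_op p A x + cpoly_op q A x.
Proof.
rewrite (cpoly_op_widen _ _ (size_polyD p q)).
rewrite (cpoly_op_widen _ _ (leq_maxl (size p) (size q))).
rewrite (cpoly_op_widen _ _ (leq_maxr (size p) (size q))) -big_split.
by apply: eq_bigr => i _; rewrite coefD scalerDl.
Qed.

Lemma cpoly_opZ a (p : {poly R[i]}) A x : cpoly_op (a *: p) A x = a *: cpoly_op p A x.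
Proof.
rewrite (cpoly_op_widen _ _ (size_scale_leq a p)) scaler_sumr.
by apply: eq_bigr => i _; rewrite coefZ scalerA.
Qed.

Lemma cpoly_opC a A x : cpoly_op a%:P A x = a *: x.
Proof.
rewrite (cpoly_op_widen _ _ (size_polyC_leq1 a)) big_ord1 coefC eqxx//=.
Qed.

Lemma cpoly_opMX (p : {poly R[i]}) A x : cpoly_op (p * 'X) A x = cpoly_op p A (A x).
Proof.
have s : (size (p * 'X)%R <= (size p).+1)%N.
  by have [->|p0] := eqVneq p 0; rewrite ?mul0r ?size_poly0// size_mulX.
rewrite (cpoly_op_widen _ _ s) big_ord_recl coefMX eqxx scale0r add0r.
by apply: eq_bigr => i _; rewrite coefMX /= -iterSr.
Qed.

Lemma cpoly_op_comm (p : {poly R[i]}) A x : linear A ->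
  cpoly_op p A (A x) = A (cpoly_op p A x).
Proof.
move=> lA; elim/poly_ind: p x => [|p c IH] x.
  by rewrite -polyC0 !cpoly_opC !scale0r lin0.
by rewrite !cpoly_opD !cpoly_opMX !cpoly_opC (linD lA) -IH (linZ lA).
Qed.

Lemma cpoly_opM (p q : {poly R[i]}) A x : linear A ->
  cpoly_op (p * q) A x = cpoly_op p A (cpoly_op q A x).
Proof.
move=> lA; elim/poly_ind: p x => [|p c IH] x.
  by rewrite mul0r -polyC0 !cpoly_opC !scale0r.
rewrite mulrDl mulrAC !cpoly_opD !cpoly_opMX mul_polyC cpoly_opZ cpoly_opC IH.
by rewrite cpoly_op_comm.
Qed.

Lemma poly_opE p A x : poly_op p A x = cpoly_op (map_poly (real_complex R) p) A x.
Proof.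
by rewrite /cpoly_op size_map_poly; apply: eq_bigr => i _; rewrite coef_map.
Qed.

Lemma poly_opD p q A x : poly_op (p + q) A x = poly_op p A x + poly_op q A x.
Proof. by rewrite !poly_opE rmorphD cpoly_opD. Qed.
Lemma poly_opM p q A x : linear A ->
  poly_op (p * q) A x = poly_op p A (poly_op q A x).
Proof. by move=> lA; rewrite !poly_opE rmorphM cpoly_opM. Qed.
Lemma poly_opC (c : R) A x : poly_op c%:P A x = c%:C *: x.
Proof. by rewrite poly_opE map_polyC cpoly_opC. Qed.
Lemma poly_op1 A x : poly_op 1 A x = x.
Proof. by rewrite poly_opC scale1r. Qed.
Lemma poly_opX A x : poly_op 'X A x = A x.
Proof. by rewrite poly_opE map_polyX -(mul1r 'X) cpoly_opMX cpoly_opC scale1r. Qed.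
Lemma poly_opZ (c : R) p A x : linear A -> poly_op (c *: p) A x = c%:C *: poly_op p A x.
Proof. by move=> lA; rewrite -mul_polyC poly_opM// poly_opC. Qed.
Lemma poly_opN p A x : linear A -> poly_op (- p) A x = - poly_op p A x.
Proof. by move=> lA; rewrite -scaleN1r poly_opZ// rmorphN scaleN1r. Qed.
Lemma poly_opB p q A x : linear A -> poly_op (p - q) A x = poly_op p A x - poly_op q A x.
Proof. by move=> lA; rewrite poly_opD poly_opN. Qed.
Lemma poly_op_comm p A x : linear A -> poly_op p A (A x) = A (poly_op p A x).
Proof. by move=> lA; rewrite !poly_opE cpoly_op_comm. Qed.

Lemma poly_op_bounded p A : bounded_op A -> bounded_op (poly_op p A).
Proof.
move=> bA; have [lA _] := bA; elim/poly_ind: p => [|p c IH].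
  rewrite (_ : poly_op 0 A = fun=> 0); first exact: bounded_op0.
  by apply/funext => x; rewrite -polyC0 poly_opC scale0r.
rewrite (_ : poly_op _ A = fun x => (poly_op p A \o A) x + c%:C *: x).
  apply: bounded_opD; first exact: bounded_op_comp.
  by apply: bounded_opZ; apply: bounded_op_id.
by apply/funext => x; rewrite poly_opD poly_opM// poly_opX poly_opC.
Qed.

Definition selfadj A := forall x y, inner (A x) y = inner x (A y).

Lemma selfadj_rip A x y : selfadj A -> rip (A x) y = rip x (A y).
Proof. by move=> sA; rewrite /rip sA. Qed.

Lemma poly_op_selfadj p A : linear A -> selfadj A -> selfadj (poly_op p A).
Proof.
move=> lA sA; elim/poly_ind: p => [|p c IH] x y.
  by rewrite -polyC0 !poly_opC innerZl innerZr conjc_real !mul0r.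
rewrite !poly_opD !poly_opM// !poly_opX !poly_opC innerDl innerDr innerZl innerZr.
by rewrite conjc_real IH sA poly_op_comm.
Qed.

Definition posop A := [/\ bounded_op A, selfadj A & forall x, 0 <= rip (A x) x].

Lemma selfadj_inner A x : selfadj A -> inner (A x) x = (rip (A x) x)%:C.
Proof.
move=> sA; rewrite /rip; have := innerC (A x) x; rewrite -sA.
case: (inner (A x) x) => u v [] /eqP; rewrite -addr_eq0 -mulr2n mulrn_eq0 /= => /eqP ->.
by [].
Qed.

(** By Cauchy-Schwarz it suffices to bound |<(A - z) x, x>| below by c |x|^2. Since <A x, x> lies
    between 0 and ||A|| |x|^2, one takes c = |Im z|, - Re z or Re z - ||A||, according to how z
    avoids the interval. *)
Lemma posop_sub_bounded_below A (z : R[i]) : posop A ->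
  (forall r : R, 0 <= r <= opnorm A -> z <> r%:C) ->
  exists2 c : R, 0 < c & forall x, c * nrm x <= nrm (A x - z *: x).
Proof.
move=> [bA sA pA] zr; case: z zr => u v zr.
have key c : 0 < c ->
    (forall x, c * nrm x ^+ 2 <= cmod (inner (A x - (u +i* v) *: x) x)) ->
    exists2 c : R, 0 < c & forall x, c * nrm x <= nrm (A x - (u +i* v) *: x).
  move=> c0 h; exists c => // x; have [x0|x0] := eqVneq (nrm x) 0.
    by rewrite x0 mulr0 nrm_ge0.
  have xp : 0 < nrm x by rewrite lt_neqAle eq_sym x0 nrm_ge0.
  rewrite -(ler_pM2r xp) -mulrA -expr2; apply: (le_trans (h x)).
  exact: cmod_inner_le.
have innerE x : inner (A x - (u +i* v) *: x) x =
    (rip (A x) x - u * nrm x ^+ 2) +i* (- (v * nrm x ^+ 2)).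
  rewrite innerDl innerNl innerZl selfadj_inner// inner_nrm.
  by apply/eqP; rewrite eq_complex /=; apply/andP; split; apply/eqP; ring.
have [v0|v0] := eqVneq v 0; last first.
  apply: (key `|v|); first by rewrite normr_gt0.
  move=> x; rewrite innerE (le_trans _ (norm_Im_le_cmod _))//= normrN normrM.
  by rewrite (ger0_norm (sqr_ge0 _)).
have [u0|u0] := ltP u 0.
  apply: (key (- u)); first by rewrite oppr_gt0.
  move=> x; rewrite innerE (le_trans _ (Re_le_cmod _))//=.
  by rewrite mulNr lerDr pA.
have [uM|uM] := ltP (opnorm A) u; last first.
  by case: (zr u); rewrite ?u0// v0.
apply: (key (u - opnorm A)); first by rewrite subr_gt0.
move=> x; rewrite innerE (le_trans _ (norm_Re_le_cmod _))//= distrC.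
rewrite (le_trans _ (ler_norm _))// mulrBl lerB// (le_trans (rip_le _ _))//.
by rewrite expr2 mulrA ler_wpM2r ?nrm_ge0// opnorm_bnd.
Qed.

Lemma poly_op_nrm_sqr q A x : linear A -> selfadj A ->
  nrm (poly_op q A x) ^+ 2 = rip (poly_op (q * q) A x) x.
Proof.
move=> lA sA; rewrite -rip_nrm poly_opM// ripC.
by rewrite (selfadj_rip _ _ (poly_op_selfadj q lA sA)) ripC.
Qed.

(* Spectral mapping: if [n] is the norm of the self-adjoint operator [q(A)],
   then [q(A)^2 - n^2] is not bounded below; hence neither is some factor
   [A - z] for a root [z] of [q^2 - n^2]. *)
Lemma opnorm_poly_op q A : posop A ->
  exists2 z, 0 <= z <= opnorm A & opnorm (poly_op q A) <= `|q.[z]|.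
Proof.
move=> posA; have [bA sA pA] := posA; have [lA _] := bA.
set n := opnorm (poly_op q A); have n0 : 0 <= n := opnorm_ge0 _.
have bq := poly_op_bounded q bA.
have [nE|/eqP n_neq0] := pselect (n = 0).
  by exists 0; rewrite ?lexx ?opnorm_ge0// nE.
have n_gt0 : 0 < n by rewrite lt_neqAle eq_sym n_neq0.
pose p := map_poly (real_complex R) (q * q - (n ^+ 2)%:P).
have rootp (z : R) : root p z%:C -> n = `|q.[z]|.
  rewrite /root horner_map /= fmorph_eq0 !hornerE subr_eq0 => /eqP h.
  by apply/eqP; rewrite -(eqrXn2 (n := 2))// -expr2 in h *; rewrite real_normK ?num_real// h.
have [zP|zN] := pselect (exists2 z : R, 0 <= z <= opnorm A & root p z%:C).
  by have [z zM /rootp zq] := zP; exists z => //; rewrite zq.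
exfalso.
have p0 : p != 0.
  apply/eqP => p0; apply: zN; exists 0; first by rewrite lexx opnorm_ge0.
  by rewrite p0 root0.
have [c c0 hc] : exists2 c : R, 0 < c & forall x, c * nrm x <= nrm (cpoly_op p A x).
  have [s ps] := closed_field_poly_normal p.
  have sP z : z \in s -> forall r : R, 0 <= r <= opnorm A -> z <> r%:C.
    move=> zs r rM zr; apply: zN; exists r => //; rewrite -zr ps.
    by rewrite rootZ ?lead_coef_eq0// root_prod_XsubC.
  have : exists2 c : R, 0 < c & forall x,
      c * nrm x <= nrm (cpoly_op (\prod_(z <- s) ('X - z%:P)) A x).
    elim: s {ps} sP => [|z s IH] sP.
      exists 1; first by [].
      by move=> x; rewrite big_nil -polyC1 cpoly_opC scale1r mul1r.
    have [|c c0 hc] := IH; first by move=> w ws; apply: sP; rewrite inE ws orbT.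
    have [d d0 hd] := posop_sub_bounded_below posA (sP z (mem_head _ _)).
    exists (d * c); first by rewrite mulr_gt0.
    move=> x; rewrite big_cons cpoly_opM//; set y := cpoly_op _ A x.
    have -> : cpoly_op ('X - z%:P) A y = A y - z *: y.
      by rewrite -polyCN cpoly_opD -(mul1r 'X) cpoly_opMX !cpoly_opC scale1r scaleNr.
    by rewrite -mulrA (le_trans _ (hd y))// ler_pM2l.
  move=> [c c0 hc]; exists (cmod (lead_coef p) * c).
    rewrite mulr_gt0// lt_neqAle cmod_ge0 andbT eq_sym.
    by rewrite -(fmorph_eq0 (real_complex R)) /= -cmodE normr_eq0 lead_coef_eq0.
  by move=> x; rewrite [in leRHS]ps cpoly_opZ nrmZ -mulrA ler_wpM2l ?cmod_ge0.
(* Square c |x| <= |q(A)^2 x - n^2 x|, expand, and use |q(A)^2 x| <= n |q(A) x|: this gives n^2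
   |q(A) x|^2 <= (n^4 - c^2) |x|^2. *)
have below x : nrm (poly_op q A x) ^+ 2 <= (n ^+ 2 - (c / n) ^+ 2) * nrm x ^+ 2.
  have px : cpoly_op p A x = poly_op (q * q) A x - (n ^+ 2)%:C *: x.
    by rewrite -poly_opE poly_opB// poly_opC.
  have := hc x; rewrite px -(ler_pXn2r (n := 2)) ?nnegrE ?nrm_ge0 ?mulr_ge0 ?nrm_ge0 ?(ltW c0)//.
  rewrite nrmB_sqr ripZr -poly_op_nrm_sqr// nrmZr ger0_norm ?sqr_ge0//.
  have : nrm (poly_op (q * q) A x) ^+ 2 <= n ^+ 2 * nrm (poly_op q A x) ^+ 2.
    rewrite poly_opM// -exprMn ler_pXn2r ?nnegrE ?mulr_ge0 ?nrm_ge0//.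
    exact: opnorm_bnd.
  rewrite !exprMn exprVn => h1 h2.
  rewrite -(ler_pM2l (exprn_gt0 2 n_gt0)).
  have -> : n ^+ 2 * ((n ^+ 2 - c ^+ 2 / n ^+ 2) * nrm x ^+ 2) =
      (n ^+ 2 * n ^+ 2 - c ^+ 2) * nrm x ^+ 2 by field.
  by move: h1 h2; rewrite mulrBl; lra.
suff : n ^+ 2 <= n ^+ 2 - (c / n) ^+ 2.
  by rewrite lerBrDr gerDl leNgt exprn_gt0// divr_gt0.
(* A nonzero vector exists because q(A) is not 0; [below] at that vector gives the sign required by
   the square root. *)
have k0 : 0 <= n ^+ 2 - (c / n) ^+ 2.
  have [x x0] : exists x : H, nrm x != 0.
    apply: contrapT => h; move: n_neq0; rewrite -/n; apply/negP; rewrite negbK.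
    rewrite eq_le n0 andbT; apply: opnorm_le => // x.
    rewrite mul0r; have [] := eqVneq (nrm (poly_op q A x)) 0; first by move=> ->.
    by move=> hx; case: h; exists (poly_op q A x).
  have := le_trans (sqr_ge0 _) (below x).
  by rewrite pmulr_lge0// lt_neqAle eq_sym expf_neq0//= sqr_ge0.
rewrite -[leRHS]sqr_sqrtr// ler_pXn2r ?nnegrE ?sqrtr_ge0//.
apply: opnorm_le; first exact: sqrtr_ge0.
move=> x; rewrite -(ler_pXn2r (n := 2)) ?nnegrE ?nrm_ge0 ?mulr_ge0 ?sqrtr_ge0 ?nrm_ge0//.
by rewrite exprMn sqr_sqrtr.
Qed.

Lemma poly_op_bnd q A e : posop A ->
  (forall z, 0 <= z <= opnorm A -> `|q.[z]| <= e) -> bnd e (poly_op q A).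
Proof.
move=> pA hq x; have [bA _ _] := pA.
rewrite (le_trans (opnorm_bnd (poly_op_bounded q bA) x))// ler_wpM2r ?nrm_ge0//.
by have [z zM] := opnorm_poly_op q pA; move/le_trans; apply; apply: hq.
Qed.

(** From 0 <= q <= 1 follows |1 - 2 q| <= 1, so <(1 - 2 q(A)) x, x> <= |x|^2, which is the claim
    after cancelling |x|^2. *)
Lemma poly_op_ge0 q A x : posop A ->
  (forall z, 0 <= z <= opnorm A -> 0 <= q.[z] <= 1) -> 0 <= rip (poly_op q A x) x.
Proof.
move=> pA hq; have [[lA _] _ _] := pA.
have h : nrm (poly_op (1 - (1 + 1) * q) A x) <= 1 * nrm x.
  apply: poly_op_bnd => // z /hq.
  by rewrite !hornerE ler_norml => /andP[? ?]; apply/andP; split; lra.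
have : rip (poly_op (1 - (1 + 1) * q) A x) x <= nrm x * nrm x.
  rewrite (le_trans (rip_le _ _))// ler_wpM2r ?nrm_ge0//.
  by rewrite -[leRHS]mul1r.
rewrite poly_opB// poly_opM// poly_opD !poly_op1 !ripE rip_nrm.
by rewrite expr2; lra.
Qed.

End PolynomialCalculus.

(** * Uniform polynomial approximation of x^s *)

Section PowerApproximation.
Context {R : realType}.
Implicit Types (g : nat -> R) (x s e M : R) (p : {poly R}).

(* [(bernstein n g).[x]] is the expectation of [g K] for a binomial variable
   [K] of parameters [n] and [x], computed by conditioning on the first trial. *)
Fixpoint bernstein n g : {poly R} :=
  if n is m.+1 then 'X * bernstein m (g \o S) + (1 - 'X) * bernstein m g
  else (g 0%N)%:P.

Lemma bernsteinN n g x : (bernstein n (fun k => - g k)).[x] = - (bernstein n g).[x].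
Proof.
elim: n g => [|n IH] g /=; first by rewrite !hornerE.
by rewrite !hornerE (IH (g \o S)) IH; ring.
Qed.

(** The right-hand side is the expectation of a + b (K - c)^2: squared bias plus variance n x (1 -
    x). A success in the first trial replaces c by c - 1, hence the induction over all [g] and
    [c]. *)
Lemma bernstein_le n g a b c x : 0 <= x <= 1 ->
  (forall k, (k <= n)%N -> g k <= a + b * (k%:R - c) ^+ 2) ->
  (bernstein n g).[x] <= a + b * ((n%:R * x - c) ^+ 2 + n%:R * x * (1 - x)).
Proof.
move=> /andP[x0 x1]; elim: n g c => [|n IH] g c hg /=.
  by rewrite hornerC !mul0r addr0; apply: hg.
have h1 := IH g c (fun k kn => hg k (leqW kn)).
have h2 : (bernstein n (g \o S)).[x] <=
    a + b * ((n%:R * x - (c - 1)) ^+ 2 + n%:R * x * (1 - x)).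
  apply: IH => k kn /=; apply: (le_trans (hg k.+1 kn)).
  by rewrite -natr1 opprB addrA.
rewrite !hornerE.
have x1' : 0 <= 1 - x by rewrite subr_ge0.
apply: (le_trans (lerD (ler_wpM2l x0 h2) (ler_wpM2l x1' h1))).
rewrite le_eqVlt; apply/orP; left; apply/eqP; rewrite -natr1; ring.
Qed.

(** Scaling reduces to x = 1, where y <= y^s and 1 - y <= (1 - y)^s give 1 <= y^s + (1 - y)^s. *)
Lemma powR_subadd s u x : 0 < s <= 1 -> 0 <= u <= x -> x `^ s - u `^ s <= (x - u) `^ s.
Proof.
move=> /andP[s0 s1] /andP[u0 ux].
have le_pow y : 0 <= y <= 1 -> y <= y `^ s.
  move=> /andP[]; rewrite le_eqVlt => /predU1P[<-|y0 y1]; first by rewrite powR_ge0.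
  by apply: ger1_powR => //; rewrite y0.
have [x0|x0] := eqVneq x 0.
  by rewrite x0 powR0 ?gt_eqF// sub0r (le_trans (y := 0)) ?powR_ge0// oppr_le0 powR_ge0.
have xp : 0 < x by rewrite lt_neqAle eq_sym x0 (le_trans u0 ux).
have [y y0 ->] : exists2 y, 0 <= y <= 1 & u = x * y.
  exists (u / x); last by rewrite mulrC mulfVK.
  by rewrite divr_ge0 ?(ltW xp)//= ler_pdivrMr// mul1r.
have y1 : 0 <= 1 - y <= 1 by move: y0 => /andP[? ?]; apply/andP; split; lra.
have -> : x - x * y = x * (1 - y) by rewrite mulrBr mulr1.
have [yp yq] := (andP y0, andP y1); rewrite !powRM ?(ltW xp) ?yp.1 ?yq.1//.
rewrite lerBlDr -mulrDr ler_peMr ?powR_ge0//.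
by have := le_pow _ y0; have := le_pow _ y1; lra.
Qed.

(** The modulus of continuity is given a quadratic form to fit [bernstein_le]. With d = e^(1/s),
    [powR_subadd] gives at most d^s = e when 0 <= x - y <= d; beyond d, C (x - y)^2 >= 1 for C =
    d^-2. *)
Lemma powR_modulus s e : 0 < s <= 1 -> 0 < e -> exists2 C, 0 <= C &
  forall x y, 0 <= x <= 1 -> 0 <= y <= 1 -> x `^ s - y `^ s <= e + C * (x - y) ^+ 2.
Proof.
move=> hs e0; have /andP[s0 s1] := hs; pose d := e `^ s^-1.
have d0 : 0 < d by rewrite powR_gt0.
exists (d ^- 2); first by rewrite invr_ge0 sqr_ge0.
move=> x y /andP[x0 x1] /andP[y0 y1].
have mono := ge0_ler_powR (ltW s0).
have [yx|xy] := leP y x; last first.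
  have : x `^ s <= y `^ s by apply: mono; rewrite ?nnegrE// ltW.
  have := mulr_ge0 (ltW (exprn_gt0 2 d0)) (sqr_ge0 (x - y)).
  have : 0 <= d ^- 2 * (x - y) ^+ 2 by rewrite mulr_ge0 ?invr_ge0 ?sqr_ge0.
  by move=> *; lra.
have [xyd|xyd] := leP (x - y) d.
  have : (x - y) `^ s <= e.
    rewrite (_ : e = d `^ s); first by apply: mono; rewrite ?nnegrE ?subr_ge0// ltW.
    by rewrite -powRrM mulVf ?gt_eqF// powRr1// ltW.
  have := @powR_subadd s y x hs; rewrite y0 yx => /(_ isT).
  have : 0 <= d ^- 2 * (x - y) ^+ 2 by rewrite mulr_ge0 ?invr_ge0 ?sqr_ge0.
  by move=> *; lra.
have : 1 <= d ^- 2 * (x - y) ^+ 2.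
  rewrite mulrC ler_pdivlMr ?exprn_gt0// mul1r ler_pXn2r ?nnegrE ?subr_ge0// ltW//.
have : x `^ s <= 1.
  by have := mono x 1; rewrite !nnegrE powR1; apply.
have := powR_ge0 y s.
by move=> *; lra.
Qed.

Lemma powR_poly_approx1 s e : 0 < s <= 1 -> 0 < e ->
  exists p, forall x, 0 <= x <= 1 -> `|p.[x] - x `^ s| <= e.
Proof.
move=> hs e0; have e20 : 0 < e / 2 by rewrite divr_gt0.
have [C C0 hC] := powR_modulus hs e20.
(* The variance of K / n is x (1 - x) / n <= 1 / n, so the quadratic term contributes at most C /
   n. *)
have [n n0 nC] : exists2 n, 0 < n%:R :> R & C / n%:R <= e / 2.
  exists (Num.bound (C / (e / 2))).+1; first by rewrite ltr0n.
  rewrite ler_pdivrMr ?ltr0n// mulrC -ler_pdivrMr//.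
  rewrite ltW// (@lt_le_trans _ _ (Num.bound (C / (e / 2)))%:R)//.
    by apply: archi_boundP; rewrite divr_ge0// ltW.
  by rewrite ler_nat.
pose g k : R := (k%:R / n%:R) `^ s.
exists (bernstein n g) => x /andP[x0 x1].
have kn k : (k <= n)%N -> 0 <= k%:R / n%:R :> R /\ k%:R / n%:R <= 1 :> R.
  by move=> kn; split; [rewrite divr_ge0 ?ler0n|rewrite ler_pdivrMr// mul1r ler_nat].
have sq k : C * (k%:R / n%:R - x) ^+ 2 = C / n%:R ^+ 2 * (k%:R - n%:R * x) ^+ 2.
  by field; rewrite gt_eqF.
have e1 : C / n%:R ^+ 2 * ((n%:R * x - n%:R * x) ^+ 2 + n%:R * x * (1 - x)) <= e / 2.
  rewrite subrr expr0n add0r; apply: le_trans nC.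
  rewrite (_ : _ * _ = C / n%:R * (x * (1 - x))); last by field; rewrite gt_eqF.
  by rewrite ler_piMr ?divr_ge0// ?ltW//; nra.
(* [bernstein_le] only bounds from above; the lower bound comes from applying it to - g. *)
rewrite ler_norml; apply/andP; split.
  rewrite lerBrDl -lerN2 -bernsteinN.
  have -> : - (x `^ s - e) = - x `^ s + e / 2 + e / 2 by field.
  apply: le_trans (lerD (lexx _) e1); apply: bernstein_le; first by rewrite x0.
  move=> k /kn[kn0 kn1]; rewrite -sq.
  have := hC x (k%:R / n%:R); rewrite x0 x1 kn0 kn1 => /(_ isT isT).
  by rewrite -(opprB x) sqrrN /g => *; lra.
rewrite lerBlDl; have -> : x `^ s + e = x `^ s + e / 2 + e / 2 by field.
apply: le_trans (lerD (lexx _) e1); apply: bernstein_le; first by rewrite x0.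
move=> k /kn[kn0 kn1]; rewrite -sq.
have := hC (k%:R / n%:R) x; rewrite x0 x1 kn0 kn1 => /(_ isT isT).
by rewrite /g => *; lra.
Qed.

Lemma powR_poly_approx s M e : 0 < s <= 1 -> 0 <= M -> 0 < e ->
  exists p, forall x, 0 <= x <= M -> `|p.[x] - x `^ s| <= e.
Proof.
move=> hs; rewrite le_eqVlt => /predU1P[<- e0|M0 e0].
  exists 0 => x /andP[x0 x1]; have -> : x = 0 by apply/le_anti/andP.
  have /andP[s0 _] := hs.
  by rewrite horner0 powR0 ?gt_eqF// subrr normr0 ltW.
have Ms : 0 < M `^ s by rewrite powR_gt0.
have [p hp] := powR_poly_approx1 hs (divr_gt0 e0 Ms).
exists (M `^ s *: (p \Po (M^-1 *: 'X))) => x /andP[x0 xM].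
have := hp (x / M); rewrite divr_ge0 ?(ltW M0)// ler_pdivrMr// mul1r xM => /(_ isT).
rewrite ler_pdivlMr// mulrC -{1}(ger0_norm (ltW Ms)) -normrM mulrBr -powRM ?divr_ge0 ?(ltW M0)//.
by rewrite hornerZ horner_comp hornerZ hornerX (mulrC M^-1) mulrCA divff ?gt_eqF// mulr1.
Qed.

End PowerApproximation.

(** * Continuous functional calculus by polynomial approximation *)

Section FunctionalCalculus.
Context {R : realType} {H : hilbertType R}.
Implicit Types (A B C D : H -> H) (x y : H) (p q : {poly R}) (f g : R -> R).

(** The restriction to e <= 1 lets products of errors be absorbed into a term linear in e. *)
Lemma le_eps_lin (r K : R) : (forall e, 0 < e <= 1 -> r <= K * e) -> r <= 0.
Proof.
move=> h; apply/ler_addgt0Pl => e e0; rewrite addr0.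
pose d := Num.min 1 (e / (`|K| + 1)).
have K0 : 0 < `|K| + 1 by rewrite ltr_wpDl.
have d0 : 0 < d by rewrite lt_min ltr01 divr_gt0.
rewrite (le_trans (h d _)) ?d0 ?ge_min ?lexx//.
rewrite (le_trans (y := (`|K| + 1) * d))//.
  by rewrite ler_pM2r// (le_trans (ler_norm _))// lerDl.
by rewrite mulrC -ler_pdivlMr// ge_min lexx orbT.
Qed.

Lemma nrm_eps_lin x (K : R) : (forall e, 0 < e <= 1 -> nrm x <= K * e) -> x = 0.
Proof.
by move=> h; apply/nrm_eq0/le_anti; rewrite nrm_ge0 andbT; apply: le_eps_lin h.
Qed.

Lemma tends_linear (T : nat -> H -> H) B : (forall n, linear (T n)) ->
  (forall x, tends (T^~ x) (B x)) -> linear B.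
Proof.
move=> lT TB a x y; apply: (tends_uniq (TB _)).
under eq_fun do rewrite lT.
by apply: tendsD; [apply: tendsZ|].
Qed.

Lemma tendsB (u v : nat -> H) x y :
  tends u x -> tends v y -> tends (fun n => u n - v n) (x - y).
Proof.
move=> ux vy; rewrite -(scaleN1r y); under eq_fun do rewrite -scaleN1r.
by apply: tendsD => //; apply: tendsZ.
Qed.

Lemma tends_nrm_le (u : nat -> H) l (v : nat -> R) (r : R) : tends u l ->
  v @ \oo --> r -> (forall n, nrm (u n) <= v n) -> nrm l <= r.
Proof.
by move=> /tends_nrm ul vr uv; apply: (ler_cvg_to ul vr); apply: nearW.
Qed.

(** Epsilon form of [is_fun_calc]: one polynomial is close to f uniformly and to B in norm, so no
    sequences have to be synchronised when several operators occur. *)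
Definition approx_calc f A B := forall e : R, 0 < e -> exists p,
  (forall z, 0 <= z <= opnorm A -> `|p.[z] - f z| <= e) /\
  bnd e (fun x => poly_op p A x - B x).

Lemma is_fun_calc_approx f A B : bounded_op A -> is_fun_calc f A B -> approx_calc f A B.
Proof.
move=> bA [bB [p [unif lim]]] e e0.
have unifN : \forall k \near \oo, forall z, 0 <= z <= opnorm A -> `|(p k).[z] - f z| <= e.
  have : nbhs (f : {uniform` [set` `[0, opnorm A]] -> R})
      [set h | forall z, 0 <= z <= opnorm A -> `|h z - f z| <= e].
    apply/uniform_nbhs; exists [set xy | ball xy.1 e xy.2]; split.
      by rewrite -entourage_from_ballE; exists e.
    move=> h /= hh z zM; have := hh z; rewrite /= in_itv /= => /(_ zM).
    by rewrite /ball /= distrC => /ltW.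
  by move/unif.
have limN : \forall k \near \oo, opnorm (fun x => poly_op (p k) A x - B x) <= e.
  move/cvgrPdist_le : lim => /(_ e e0); apply: filterS => k.
  by rewrite sub0r normrN ger0_norm ?opnorm_ge0.
have [k [hk1 hk2]] := filter_ex (filterI unifN limN).
have bd := bounded_opB (poly_op_bounded (p k) bA) bB.
exists (p k); split => // x; apply: le_trans (opnorm_bnd bd x) _.
by rewrite ler_wpM2r ?nrm_ge0.
Qed.

(** Take p_n within 1/(n+1) of f. By the spectral bound the p_n(A) are Cauchy in norm; B is their
    pointwise limit, and letting m tend to infinity in [pB] shows that the convergence holds in
    norm. *)
Lemma fun_calc_exists f A : posop A ->
  (forall e : R, 0 < e -> exists p, forall z, 0 <= z <= opnorm A -> `|p.[z] - f z| <= e) ->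
  exists B, is_fun_calc f A B.
Proof.
move=> pA happrox; have [bA sA _] := pA; have [lA _] := bA.
pose e k : R := k.+1%:R^-1.
have e_gt0 k : 0 < e k by rewrite invr_gt0 ltr0n.
have e_cvg : e @ \oo --> (0 : R) := cvg_harmonic.
have [p hp] := choice (fun k => happrox (e k) (e_gt0 k)).
have pB n m x : nrm (poly_op (p n) A x - poly_op (p m) A x) <= (e n + e m) * nrm x.
  rewrite -poly_opB//; apply: poly_op_bnd => // z zM.
  rewrite hornerD hornerN; have := hp n z zM; have := hp m z zM.
  by rewrite !ler_norml => /andP[? ?] /andP[? ?]; apply/andP; split; lra.
have lim x : exists l, tends (fun n => poly_op (p n) A x) l.
  apply: cauchy_tends => d d0.
  have : (e n * (2 * nrm x)) @[n --> \oo] --> (0 : R).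
    by rewrite -(mul0r (2 * nrm x)); apply: cvgMr_tmp.
  move/cvgrPdist_lt => /(_ d d0) [N _ hN]; exists N => n m Nn Nm.
  apply: le_lt_trans (pB n m x) _.
  have := hN n Nn; have := hN m Nm; rewrite /= !sub0r !normrN.
  by rewrite !ger0_norm ?mulr_ge0 ?nrm_ge0 ?(ltW (e_gt0 _))// => *; lra.
have [B hB] := choice lim.
have bndB n : bnd (e n) (fun x => poly_op (p n) A x - B x).
  move=> x; apply: (tends_nrm_le (tendsB (tends_cst (poly_op (p n) A x)) (hB x)) _ (pB n ^~ x)).
  apply: cvgMr_tmp; rewrite -[X in _ --> X]addr0.
  by apply: cvgD => //; exact: cvg_cst.
have lB : linear B.
  by apply: (tends_linear _ hB) => n; apply/bounded_op_lin/poly_op_bounded.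
have bB : bounded_op B.
  apply/bounded_opP; split => //; exists (opnorm (poly_op (p 0%N) A) + e 0%N).
    by rewrite addr_ge0 ?opnorm_ge0// ltW.
  move=> x; have := bndB 0%N x; have := opnorm_bnd (poly_op_bounded (p 0%N) bA) x.
  have := nrmD (poly_op (p 0%N) A x) (B x - poly_op (p 0%N) A x).
  by rewrite subrKC nrmBC mulrDl => *; lra.
exists B; split => //; exists p; split.
  move=> P /uniform_nbhs[E [entE hE]].
  move: entE; rewrite -entourage_from_ballE => -[d /= d0 hd].
  move/cvgrPdist_lt : e_cvg => /(_ d d0); apply: filterS => k.
  rewrite sub0r normrN ger0_norm ?(ltW (e_gt0 _))// => ekd.
  apply: hE => z; rewrite /= in_itv /= => zM; apply: hd; rewrite /ball /= distrC.
  exact: le_lt_trans (hp k z zM) ekd.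
apply: (squeeze_cvgr _ (cvg_cst 0) e_cvg); apply: nearW => k.
rewrite opnorm_ge0 /=; apply: opnorm_le; [exact: ltW|exact: bndB].
Qed.

Lemma approx_calc_nrm f A B F : posop A -> 0 <= F -> approx_calc f A B ->
  (forall z, 0 <= z <= opnorm A -> `|f z| <= F) -> bnd F B.
Proof.
move=> pA F0 hB hf x; rewrite -subr_le0; apply: (@le_eps_lin _ (2 * nrm x)).
move=> e /andP[e0 _]; have [p [hp hpB]] := hB e e0.
have hpx : nrm (poly_op p A x) <= (F + e) * nrm x.
  apply: poly_op_bnd => // z zM; have := hp z zM; have := hf z zM.
  by rewrite !ler_norml => /andP[? ?] /andP[? ?]; apply/andP; split; lra.
have := hpB x; have := nrmD (poly_op p A x) (B x - poly_op p A x).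
by rewrite subrKC nrmBC; move: hpx; rewrite mulrDl => *; lra.
Qed.

Lemma approx_calc_selfadj f A B : posop A -> approx_calc f A B -> selfadj B.
Proof.
move=> pA hB x y; have [[lA _] sA _] := pA.
apply/eqP; rewrite -subr_eq0 -normr_eq0 cmodE fmorph_eq0 /=.
rewrite eq_le cmod_ge0 andbT; apply: (@le_eps_lin _ (2 * (nrm x * nrm y))).
move=> e /andP[e0 _]; have [p [_ hpB]] := hB e e0.
have sp := poly_op_selfadj p lA sA.
have -> : inner (B x) y - inner x (B y) =
    inner x (poly_op p A y - B y) - inner (poly_op p A x - B x) y.
  by rewrite innerDr innerDl innerNr innerNl sp; ring.
rewrite (le_trans (cmodB _ _))// (le_trans (lerD (cmod_inner_le _ _) (cmod_inner_le _ _)))//.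
have := ler_wpM2l (nrm_ge0 x) (hpB y); have := ler_wpM2r (nrm_ge0 y) (hpB x).
by move=> *; lra.
Qed.

(** Both p q and r are close to h on [0, ||A||], so p(A) q(A) and r(A) are close by the spectral
    bound. With g = 1 and C = id this also serves to identify two operators having the same
    calculus. *)
Lemma approx_calcM f g h A B C D F G : posop A -> bounded_op B -> 0 <= F -> 0 <= G ->
  (forall z, 0 <= z <= opnorm A -> `|f z| <= F) ->
  (forall z, 0 <= z <= opnorm A -> `|g z| <= G) ->
  (forall z, 0 <= z <= opnorm A -> f z * g z = h z) ->
  approx_calc f A B -> approx_calc g A C -> approx_calc h A D -> B \o C = D.
Proof.
move=> pA bB F0 G0 hf hg hfg hB hC hD; have [[lA _] _ _] := pA.
apply/funext => x /=; apply/eqP; rewrite -subr_eq0; apply/eqP.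
(* The summands account for B (C - q(A)), (B - p(A)) q(A), p(A) q(A) - r(A) and r(A) - D, each up to
   the factor e |x|; G + 1 bounds q on [0, ||A||]. *)
apply: (@nrm_eps_lin _ ((opnorm B + (G + 1) + (F + G + 2) + 1) * nrm x)).
move=> e /andP[e0 e1].
have [p [hp hpB]] := hB e e0; have [q [hq hqC]] := hC e e0; have [r [hr hrD]] := hD e e0.
set y := poly_op q A x.
have h1 : nrm (B (C x - y)) <= opnorm B * (e * nrm x).
  rewrite (le_trans (opnorm_bnd bB _))// ler_wpM2l ?opnorm_ge0// nrmBC.
  exact: hqC.
have h2 : nrm (B y - poly_op p A y) <= e * ((G + 1) * nrm x).
  rewrite nrmBC (le_trans (hpB y))// ler_wpM2l ?(ltW e0)// /y.
  apply: poly_op_bnd => // z zM; have := hq z zM; have := hg z zM.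
  by rewrite !ler_norml => /andP[? ?] /andP[? ?]; apply/andP; split; lra.
have h3 : nrm (poly_op p A y - poly_op r A x) <= (F + G + 2) * e * nrm x.
  rewrite -poly_opM// -poly_opB//; apply: poly_op_bnd => // z zM.
  rewrite hornerD hornerN hornerM.
  have -> : p.[z] * q.[z] - r.[z] =
      (p.[z] - f z) * (q.[z] - g z) + (p.[z] - f z) * g z + f z * (q.[z] - g z)
      - (r.[z] - h z) by rewrite -hfg//; ring.
  have k1 : `|(p.[z] - f z) * (q.[z] - g z)| <= e.
    by rewrite normrM -[leRHS]mulr1 ler_pM ?hp ?(le_trans (hq z zM)).
  have k2 : `|(p.[z] - f z) * g z| <= e * G by rewrite normrM ler_pM ?hp ?hg.
  have k3 : `|f z * (q.[z] - g z)| <= F * e by rewrite normrM ler_pM ?hf ?hq.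
  have k4 := hr z zM.
  move: k1 k2 k3 k4; rewrite !ler_norml.
  by move=> /andP[? ?] /andP[? ?] /andP[? ?] /andP[? ?]; apply/andP; split; lra.
have h4 := hrD x.
have -> : B (C x) - D x = B (C x - y) + (B y - poly_op p A y) +
    (poly_op p A y - poly_op r A x) + (poly_op r A x - D x).
  by rewrite (linB (bounded_op_lin bB)) !addrA !subrK.
have t1 := nrmD (B (C x - y) + (B y - poly_op p A y) +
    (poly_op p A y - poly_op r A x)) (poly_op r A x - D x).
have t2 := nrmD (B (C x - y) + (B y - poly_op p A y)) (poly_op p A y - poly_op r A x).
have t3 := nrmD (B (C x - y)) (B y - poly_op p A y).
apply: (le_trans t1); apply: (le_trans (lerD t2 h4)).
apply: (le_trans (lerD (lerD t3 h3) (lexx _))).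
apply: (le_trans (lerD (lerD (lerD h1 h2) (lexx _)) (lexx _))).
by rewrite le_eqVlt; apply/orP; left; apply/eqP; ring.
Qed.

Lemma approx_calc_id A : linear A -> approx_calc id A A.
Proof.
move=> lA e e0; exists 'X; split=> [z _|x]; first by rewrite hornerX subrr normr0 ltW.
by rewrite poly_opX subrr nrm0 mulr_ge0 ?nrm_ge0 ?ltW.
Qed.

Lemma approx_calc_cst1 A : approx_calc (cst 1) A id.
Proof.
move=> e e0; exists 1; split=> [z _|x]; first by rewrite hornerC subrr normr0 ltW.
by rewrite poly_op1 subrr nrm0 mulr_ge0 ?nrm_ge0 ?ltW.
Qed.

End FunctionalCalculus.

(** * Adjoints and powers *)

Section Adjoint.
Context {R : realType} {H : hilbertType R}.
Implicit Types (S T : H -> H) (x y z : H).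

(* Riesz representation: the minimizer of [|x|^2 - 2 phi x] represents [phi]. *)
Lemma riesz (phi : H -> R) (K : R) : {morph phi : x y / x + y} ->
  (forall r x, phi (r%:C *: x) = r * phi x) -> (forall x, phi x <= K * nrm x) ->
  exists z, forall x, phi x = rip x z.
Proof.
move=> phiD phiZ phiK; pose J x := nrm x ^+ 2 - 2 * phi x.
pose m := inf (range J).
have Jlb x : - K ^+ 2 <= J x.
  by rewrite /J; have := phiK x; have := sqr_ge0 (nrm x - K); nra.
have Jinf : has_inf (range J).
  split; first by exists (J 0); exists 0.
  by exists (- K ^+ 2) => _ [x _ <-].
have Jm x : m <= J x by apply: ge_inf; [exact: Jinf.2|exists x].
have minseq n : exists x, J x < m + n.+1%:R^-1.
  have e0 : 0 < n.+1%:R^-1 :> R by rewrite invr_gt0 ltr0n.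
  by have [_ [x _ <-] hx] := inf_adherent e0 Jinf; exists x.
have [u hu] := choice minseq.
have e_cvg : (fun n => n.+1%:R^-1 : R) @ \oo --> (0 : R) := cvg_harmonic.
(* Parallelogram law, with J at least m at the midpoint of a and b; it makes a minimizing sequence
   Cauchy. *)
have para a b : nrm (a - b) ^+ 2 <= 2 * (J a + J b - 2 * m).
  have := Jm ((2^-1)%:C *: (a + b)).
  rewrite /J nrmZr phiZ phiD exprMn nrmD_sqr nrmB_sqr.
  rewrite ger0_norm ?invr_ge0// => h; lra.
have [z uz] : exists z, tends u z.
  apply: cauchy_tends => e e0.
  have e20 : 0 < e ^+ 2 / 4 by rewrite divr_gt0// exprn_gt0.
  move/cvgrPdist_lt : (e_cvg) => /(_ _ e20) [N _ hN]; exists N => n k Nn Nk.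
  rewrite -(ltr_pXn2r (n := 2)) ?nnegrE ?nrm_ge0 ?(ltW e0)//.
  apply: (le_lt_trans (para _ _)).
  have small j : (N <= j)%N -> j.+1%:R^-1 < e ^+ 2 / 4.
    by move=> /hN; rewrite sub0r normrN ger0_norm ?invr_ge0.
  have := hu n; have := hu k; have := small n Nn; have := small k Nk; rewrite /J.
  move: (n.+1%:R^-1) (k.+1%:R^-1) => *; lra.
exists z => v.
(* Compare J (u n + s v) >= m > J (u n) - 1/(n+1) and let n tend to infinity. *)
have key (s : R) : 0 <= 2 * s * (rip z v - phi v) + s ^+ 2 * nrm v ^+ 2.
  have cv : (2 * s * (rip (u n) v - phi v) + s ^+ 2 * nrm v ^+ 2 + n.+1%:R^-1)
      @[n --> \oo] --> 2 * s * (rip z v - phi v) + s ^+ 2 * nrm v ^+ 2 + 0.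
    apply: cvgD => //; apply: cvgD; last exact: cvg_cst.
    by apply: cvgMl_tmp; apply: cvgB; [apply: tends_rip|exact: cvg_cst].
  rewrite -[leRHS]addr0; apply: (cvgr_to_ge cv); apply: nearW => n.
  have := Jm (u n + s%:C *: v); have := hu n.
  rewrite /J nrmD_sqr phiD phiZ nrmZr exprMn real_normK ?num_real// ripZr.
  move: (n.+1%:R^-1) => e *; lra.
set d := rip z v - phi v in key.
suff : d = 0 by rewrite /d ripC => /eqP; rewrite subr_eq0 => /eqP.
have q0 : 0 < nrm v ^+ 2 + 1 by rewrite ltr_wpDl ?sqr_ge0.
(* The quadratic in s is least at - d / |v|^2; adding 1 to the denominator also covers v = 0. *)
have := key (- d / (nrm v ^+ 2 + 1)).
move: q0; set q := nrm v ^+ 2 => q0.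
have -> : 2 * (- d / (q + 1)) * d + (- d / (q + 1)) ^+ 2 * q =
   - (d ^+ 2 * (q + 2) / (q + 1) ^+ 2) by field; rewrite gt_eqF.
rewrite oppr_ge0 pmulr_lle0 ?invr_gt0 ?exprn_gt0// pmulr_lle0.
  by move=> h; apply/eqP; rewrite -sqrf_eq0 eq_le h sqr_ge0.
by have := sqr_ge0 (nrm v); rewrite /q; lra.
Qed.

(** Replacing x by i x exposes the imaginary part, up to sign, as a real part. *)
Lemma rip_inner T S : linear T -> (forall x y, rip (T x) y = rip x (S y)) ->
  forall x y, inner (T x) y = inner x (S y).
Proof.
move=> lT h x y; have := h x y; have := h ('i%C *: x) y.
rewrite linZ// /rip !innerZl ![_ * inner _ _]mulrC !ReiNIm => /oppr_inj hI hR.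
by apply/eqP; rewrite eq_complex hI hR !eqxx.
Qed.

Lemma adjoint_exists T : bounded_op T ->
  exists S, bounded_op S /\ forall x y, inner (T x) y = inner x (S y).
Proof.
move=> bT; have [lT _] := bT.
have ex y : exists z, forall x, rip (T x) y = rip x z.
  apply: (@riesz (fun x => rip (T x) y) (opnorm T * nrm y)).
  - by move=> a b; rewrite linD// ripDl.
  - by move=> r x; rewrite linZ// ripZl.
  - move=> x; rewrite (le_trans (rip_le _ _))// mulrAC ler_wpM2r ?nrm_ge0//.
    exact: opnorm_bnd.
have [S hS] := choice ex.
have hS' := rip_inner lT (fun x y => hS y x).
exists S; split => //; apply/bounded_opP; split.
  move=> a x y; apply: rip_inj => z; rewrite ripC [RHS]ripC /rip.
  by rewrite innerDr innerZr -!hS' innerDr innerZr.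
exists (opnorm T) => [|y]; first exact: opnorm_ge0.
have [y0|y0] := eqVneq (nrm (S y)) 0.
  by rewrite y0 mulr_ge0 ?opnorm_ge0 ?nrm_ge0.
have yp : 0 < nrm (S y) by rewrite lt_neqAle eq_sym y0 nrm_ge0.
rewrite -(ler_pM2r yp) -expr2 -rip_nrm -hS (le_trans (rip_le _ _))//.
by rewrite mulrAC ler_wpM2r ?nrm_ge0//; apply: opnorm_bnd.
Qed.

Lemma adjointP T : bounded_op T ->
  bounded_op (adjoint T) /\ forall x y, inner (T x) y = inner x (adjoint T y).
Proof.
by move=> bT; apply: xgetPex (adjoint_exists bT).
Qed.

Lemma adjoint_bounded T : bounded_op T -> bounded_op (adjoint T).
Proof. by move=> /adjointP[]. Qed.

Lemma adjoint_rip T x y : bounded_op T -> rip (T x) y = rip x (adjoint T y).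
Proof. by move=> /adjointP[_ h]; rewrite /rip h. Qed.

Lemma adjoint_ripr T x y : bounded_op T -> rip x (T y) = rip (adjoint T x) y.
Proof. by move=> bT; rewrite ripC adjoint_rip// ripC. Qed.

(** |S y|^2 = Re <T (S y), y> <= K |S y| |y|. *)
Lemma bnd_from_adjoint T S (K : R) : 0 <= K -> (forall x y, rip (T x) y = rip x (S y)) ->
  bnd K T -> bnd K S.
Proof.
move=> K0 hS hT y; have [y0|y0] := eqVneq (nrm (S y)) 0.
  by rewrite y0 mulr_ge0 ?nrm_ge0.
have yp : 0 < nrm (S y) by rewrite lt_neqAle eq_sym y0 nrm_ge0.
rewrite -(ler_pM2r yp) -expr2 -rip_nrm -hS (le_trans (rip_le _ _))//.
by rewrite mulrAC ler_wpM2r ?nrm_ge0.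
Qed.

Lemma adjoint_bnd T (K : R) : bounded_op T -> 0 <= K -> bnd K T -> bnd K (adjoint T).
Proof. by move=> bT K0; apply: bnd_from_adjoint => // x y; apply: adjoint_rip. Qed.

Lemma posop_adjoint_comp T : bounded_op T -> posop (adjoint T \o T).
Proof.
move=> bT; have bA := adjoint_bounded bT; have [_ hT] := adjointP bT; split.
- exact: bounded_op_comp.
- by move=> x y /=; rewrite innerC -hT -innerC hT.
- by move=> x /=; rewrite -adjoint_ripr// rip_nrm sqr_ge0.
Qed.

End Adjoint.

(** * Powers of a positive operator and the absolute value *)

Section Powers.
Context {R : realType} {H : hilbertType R}.
Implicit Types (A S T : H -> H) (x y : H) (s r : R).

Section PowersOfPositive.
Variables (A : H -> H) (pA : posop A).

Lemma op_pow_calc s : 0 < s <= 1 -> is_fun_calc (fun z => z `^ s) A (op_pow A s).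
Proof.
move=> hs.
suff : exists B, is_fun_calc (fun z => z `^ s) A B by move=> /xgetPex; apply.
apply: fun_calc_exists => // e e0.
by apply: powR_poly_approx => //; apply: opnorm_ge0.
Qed.

Lemma op_pow_bounded s : 0 < s <= 1 -> bounded_op (op_pow A s).
Proof. by move=> /op_pow_calc[]. Qed.

Let bA : bounded_op A. Proof. by case: pA. Qed.

Lemma op_pow_approx s : 0 < s <= 1 -> approx_calc (fun z => z `^ s) A (op_pow A s).
Proof. by move=> /op_pow_calc /(is_fun_calc_approx bA). Qed.

Lemma op_pow_selfadj s : 0 < s <= 1 -> selfadj (op_pow A s).
Proof. by move=> /op_pow_approx; apply: approx_calc_selfadj. Qed.

Let powR_bound s z : 0 < s <= 1 -> 0 <= z <= opnorm A -> `|z `^ s| <= opnorm A `^ s.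
Proof.
move=> /andP[s0 s1] /andP[z0 zM]; rewrite ger0_norm ?powR_ge0//.
by apply: ge0_ler_powR; rewrite ?nnegrE ?opnorm_ge0// ltW.
Qed.

Lemma op_pow_bnd s : 0 < s <= 1 -> bnd (opnorm A `^ s) (op_pow A s).
Proof.
move=> hs; apply: (approx_calc_nrm pA _ (op_pow_approx hs)); first exact: powR_ge0.
by move=> z; apply: powR_bound.
Qed.

Lemma op_powD s r : 0 < s <= 1 -> 0 < r <= 1 -> s + r <= 1 ->
  op_pow A s \o op_pow A r = op_pow A (s + r).
Proof.
move=> hs hr hsr; have hsr' : 0 < s + r <= 1.
  by move: hs hr => /andP[? ?] /andP[? ?]; rewrite hsr addr_gt0.
apply: (approx_calcM pA (op_pow_bounded hs) (powR_ge0 (opnorm A) s)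
  (powR_ge0 (opnorm A) r) _ _ _ (op_pow_approx hs) (op_pow_approx hr) (op_pow_approx hsr')).
- by move=> z; apply: powR_bound.
- by move=> z; apply: powR_bound.
- by move=> z _; rewrite powRD// gt_eqF//; case/andP: hsr'.
Qed.

(** The chosen power is known only through approximations of z^1; composing it with [id], the
    calculus of the constant 1, lets [approx_calcM] identify it with A. *)
Lemma op_pow1 : op_pow A 1 = A.
Proof.
have h1 : 0 < (1 : R) <= 1 by rewrite ltr01 lexx.
have [lA _] := bA; rewrite -[LHS]/(op_pow A 1 \o id).
apply: (approx_calcM pA (op_pow_bounded h1) (powR_ge0 (opnorm A) 1) ler01 _ _ _
  (op_pow_approx h1) (approx_calc_cst1 A) (approx_calc_id lA)).
- by move=> z; apply: powR_bound.
- by move=> z _; rewrite /cst normr1.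
- by move=> z /andP[z0 _]; rewrite /cst mulr1 powRr1.
Qed.

(** A^s is the square of the self-adjoint operator A^(s/2). *)
Lemma op_pow_posop s : 0 < s <= 1 -> posop (op_pow A s).
Proof.
move=> hs; split; [exact: op_pow_bounded|exact: op_pow_selfadj|move=> x].
have h2 : 0 < s / 2 <= 1.
  by move: hs => /andP[s0 s1]; rewrite divr_gt0//=; lra.
have -> : op_pow A s = op_pow A (s / 2) \o op_pow A (s / 2).
  by rewrite op_powD -?splitr//; case/andP: hs.
rewrite /= (selfadj_rip _ _ (op_pow_selfadj h2)) rip_nrm sqr_ge0//.
Qed.

End PowersOfPositive.

Section AbsoluteValue.
Variables (S : H -> H) (bS : bounded_op S).

Let half : 0 < (2^-1 : R) <= 1.
Proof. by rewrite invr_gt0 ltr0n/=; lra. Qed.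

Lemma op_abs_posop : posop (op_abs S).
Proof. by apply: op_pow_posop => //; apply: posop_adjoint_comp. Qed.

Lemma op_abs_nrm x : nrm (op_abs S x) = nrm (S x).
Proof.
have pSS := posop_adjoint_comp bS; have [_ sa _] := op_abs_posop.
have h1 : 2^-1 + 2^-1 <= 1 :> R by lra.
have /= := congr1 (fun f => f x) (op_powD pSS half half h1).
rewrite -/(op_abs S) => hx.
apply/eqP; rewrite -(eqrXn2 (n := 2)) ?nrm_ge0// -!rip_nrm selfadj_rip// hx.
rewrite (_ : 2^-1 + 2^-1 = 1); last by field.
by rewrite op_pow1//= -adjoint_rip.
Qed.

Lemma opnorm_op_abs : opnorm (op_abs S) <= opnorm S.
Proof.
by apply: opnorm_le; [exact: opnorm_ge0|move=> x; rewrite op_abs_nrm; apply: opnorm_bnd].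
Qed.

End AbsoluteValue.
End Powers.

(** * Polar decomposition *)

Section PolarDecomposition.
Context {R : realType} {H : hilbertType R}.
Implicit Types (A S T U : H -> H) (x y k : H) (s t : R).

Lemma tends_cauchy (u : nat -> H) l : tends u l -> forall e : R, 0 < e ->
  exists N, forall n m, (N <= n)%N -> (N <= m)%N -> nrm (u n - u m) < e.
Proof.
move=> /cvgrPdist_lt ul e e0; have e2 : 0 < e / 2 by rewrite divr_gt0.
have [N _ hN] := ul _ e2; exists N => n m Nn Nm.
have small j : (N <= j)%N -> nrm (u j - l) < e / 2.
  by move=> /hN; rewrite /= sub0r normrN ger0_norm ?nrm_ge0.
rewrite (le_lt_trans (nrm_triangle l _ _))// (nrmBC l) (splitr e).
by rewrite ltrD ?small.
Qed.

Lemma tends_ext (u v : nat -> H) l : (forall n, u n = v n) -> tends u l -> tends v l.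
Proof. by move=> /funext ->. Qed.

(* With [c = 1 - A / M] and [M > ||A||], the powers [c^n = 1 - A r_n(A)] decrease
   strongly to the orthogonal projection onto [ker A]. *)
Lemma ker_limit A : posop A -> exists r : nat -> {poly R}, forall x,
  exists2 k, A k = 0 & tends (fun n => x - A (poly_op (r n) A x)) k.
Proof.
move=> pA; have [bA sA _] := pA; have [lA _] := bA.
pose M := opnorm A + 1; have M0 : 0 < M by rewrite ltr_wpDl ?opnorm_ge0.
pose c n : {poly R} := (1 - M^-1 *: 'X) ^+ n.
(* Geometric sum, equal to (1 - c n) / X. *)
pose r n : {poly R} := \sum_(i < n) M^-1 *: c i.
have cr n : c n = 1 - 'X * r n.
  elim: n => [|n IH]; first by rewrite /c /r big_ord0 mulr0 subr0.
  rewrite /r big_ord_recr /= -/(r n) mulrDr opprD addrA -IH /c exprSr mulrBr mulr1.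
  by rewrite -!scalerAr mulrC.
exists r => x; pose C n := poly_op (c n) A x.
have CE n : C n = x - A (poly_op (r n) A x).
  by rewrite /C cr poly_opB// poly_op1 poly_opM// poly_opX.
have hy z : 0 <= z <= opnorm A -> 0 <= 1 - M^-1 * z <= 1.
  move=> /andP[z0 zM]; rewrite subr_ge0 lerBlDr lerDl mulr_ge0 ?invr_ge0 ?(ltW M0)// andbT.
  by rewrite mulrC ler_pdivrMr// mul1r (le_trans zM)// lerDl.
have cE n z : (c n).[z] = (1 - M^-1 * z) ^+ n.
  by rewrite /c horner_exp hornerD hornerN hornerZ hornerX hornerC.
have c01 n z : 0 <= z <= opnorm A -> 0 <= (c n).[z] <= 1.
  by move=> /hy /andP[h0 h1]; rewrite cE exprn_ge0//= exprn_ile1.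
have cmono n m z : (n <= m)%N -> 0 <= z <= opnorm A -> (c m).[z] <= (c n).[z].
  by move=> nm /hy /andP[h0 h1]; rewrite !cE ler_wiXn2l.
pose a n := rip (C n) x.
have d01 n m z : (n <= m)%N -> 0 <= z <= opnorm A -> 0 <= (c n - c m).[z] <= 1.
  move=> nm zM; rewrite hornerD hornerN subr_ge0 (cmono _ _ _ nm zM)/=.
  by have /andP[? ?] := c01 n z zM; have /andP[? ?] := c01 m z zM; lra.
have a_sub n m : (n <= m)%N -> a n - a m = rip (poly_op (c n - c m) A x) x.
  by move=> nm; rewrite poly_opB// !ripE.
have a_mono : nonincreasing_seq a.
  move=> n m nm; rewrite -subr_ge0 a_sub//.
  by apply: poly_op_ge0 => // z; apply: d01.
have a_lb : has_lbound (range a).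
  by exists 0 => _ [n _ <-]; apply: poly_op_ge0 => // z; apply: c01.
have /cvgrPdist_lt a_cvg := nonincreasing_is_cvgn a_mono a_lb.
(* The difference d = c n - c m has values in [0, 1], so d^2 <= d there and |d(A) x|^2 <= <d(A) x,
   x>. *)
have Cd n m : (n <= m)%N -> nrm (C n - C m) ^+ 2 <= a n - a m.
  move=> nm; rewrite /C -poly_opB// poly_op_nrm_sqr// a_sub//; set d := c n - c m.
  rewrite -subr_ge0 -ripNl -ripDl -poly_opB//.
  apply: poly_op_ge0 => // z /(d01 _ _ _ nm); rewrite -/d hornerD hornerN hornerM.
  by move=> /andP[? ?]; apply/andP; split; nra.
have [k Ck] : exists k, tends C k.
  apply: cauchy_tends => e e0.
  have e2 : 0 < e ^+ 2 / 2 by rewrite divr_gt0// exprn_gt0.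
  have [N _ hN] := a_cvg _ e2; exists N => n m Nn Nm.
  rewrite -(ltr_pXn2r (n := 2)) ?nnegrE ?nrm_ge0 ?(ltW e0)//.
  have := hN n Nn; have := hN m Nm; rewrite /= !ltr_norml => /andP[? ?] /andP[? ?].
  have [nm|/ltnW nm] := leqP n m.
    by apply: (le_lt_trans (Cd _ _ nm)); lra.
  by rewrite nrmBC; apply: (le_lt_trans (Cd _ _ nm)); lra.
exists k; last by apply: tends_ext Ck.
have Ck1 : tends (fun n => C n.+1) k.
  by rewrite /tends (cvg_shiftS (fun n => nrm (C n - k))).
(* Hence A (C n) tends to 0 as well as to A k. *)
have AC n : A (C n) = M%:C *: (C n - C n.+1).
  rewrite /C -poly_opB// -poly_opZ// -[LHS]poly_opX -poly_opM//; congr (poly_op _ A x).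
  rewrite /c exprSr mulrBr mulr1 opprB addrCA subrr addr0 -!scalerAr scalerA divff ?gt_eqF//.
  by rewrite scale1r mulrC.
apply: (tends_uniq (tends_op bA Ck)).
apply: (tends_ext (u := fun n => M%:C *: (C n - C n.+1))) => [n|]; first by rewrite -AC.
by rewrite -(scaler0 _ M%:C) -(subrr k); apply: tendsZ; apply: tendsB.
Qed.

(** x - k is a limit of values of the self-adjoint A, which are orthogonal to ker A. As ker A is a
    complex subspace, testing real parts on y and on i y gives the full inner product. *)
Lemma ker_decomposition A : posop A -> exists r : nat -> {poly R}, forall x,
  exists k, [/\ A k = 0, (forall y, A y = 0 -> inner (x - k) y = 0) &
    tends (fun n => A (poly_op (r n) A x)) (x - k)].
Proof.
move=> pA; have [bA sA _] := pA; have [lA _] := bA.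
have [r hr] := ker_limit pA; exists r => x; have [k Ak xk] := hr x; exists k.
have lim : tends (fun n => A (poly_op (r n) A x)) (x - k).
  by apply: tends_ext (tendsB (tends_cst x) xk) => n; rewrite subKr.
split=> // y Ay.
have ripy z : A z = 0 -> rip (x - k) z = 0.
  move=> Az; apply: (cvg_unique (@Rhausdorff R) (tends_rip (y := z) lim)).
  rewrite (_ : (fun _ => _) = fun=> 0); first exact: cvg_cst.
  apply/funext => n; rewrite selfadj_rip// Az.
  by rewrite ripC -(subrr 0) ripDl ripNl subrr.
apply/eqP; rewrite eq_complex; apply/andP; split; apply/eqP; first exact: ripy.
have := ripy ('i%C *: y); rewrite linZ// Ay scaler0 => /(_ erefl).
rewrite /rip innerZr; case: (inner (x - k) y) => u v /=.
by rewrite mul0r sub0r mulN1r opprK.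
Qed.

Lemma rip0r x : rip x 0 = 0.
Proof. by rewrite ripC -(subrr 0) ripDl ripNl subrr. Qed.

Lemma rip_self_eq0 x : rip x x = 0 -> x = 0.
Proof. by rewrite rip_nrm => /eqP; rewrite sqrf_eq0 => /eqP /nrm_eq0. Qed.

Lemma inner0_rip x y : inner x y = 0 -> rip x y = 0.
Proof. by rewrite /rip => ->. Qed.

Lemma ortho_nrm_le x k : rip (x - k) k = 0 -> nrm (x - k) <= nrm x.
Proof.
move=> xk; rewrite -(ler_pXn2r (n := 2)) ?nnegrE ?nrm_ge0//.
rewrite -[in leRHS](subrK k x) [leRHS]nrmD_sqr xk mulr0 addr0.
by rewrite lerDl sqr_ge0.
Qed.

Section Polar.
Variables (S : H -> H) (bS : bounded_op S).
Let A := op_abs S.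
Let pA : posop A. Proof. exact: op_abs_posop. Qed.
Let lA : linear A. Proof. by case: pA => -[]. Qed.
Let lS : linear S. Proof. by case: bS. Qed.
Let AS x : nrm (A x) = nrm (S x). Proof. exact: op_abs_nrm. Qed.
Let kerAS x : A x = 0 <-> S x = 0.
Proof.
by split=> h; apply: nrm_eq0; [rewrite -AS|rewrite AS]; rewrite h nrm0.
Qed.

(* [U x] is the limit of [S (r_n(A) x)], which converges because [A (r_n(A) x)] does
   and [|S y| = |A y|]. *)
Lemma polar_exists : exists U, [/\ bounded_op U, partial_isometry U,
  (forall x, U x = 0 <-> S x = 0) & S = U \o A].
Proof.
have [_ sA _] := pA.
have [r hr] := ker_decomposition pA.
have lim x : exists l, tends (fun n => S (poly_op (r n) A x)) l.
  apply: cauchy_tends => e e0; have [k [_ _ xk]] := hr x.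
  have [N hN] := tends_cauchy xk e0; exists N => n m Nn Nm.
  by rewrite -linB// -AS linB// hN.
have [U hU] := choice lim.
have Unrm x k : tends (fun n => A (poly_op (r n) A x)) (x - k) -> nrm (U x) = nrm (x - k).
  move=> xk; apply: (cvg_unique (@Rhausdorff R) (tends_nrm (hU x))).
  rewrite (_ : (fun n => _) = fun n => nrm (A (poly_op (r n) A x))); first exact: tends_nrm.
  by apply/funext => n; rewrite AS.
have lU : linear U.
  apply: (tends_linear _ hU) => n; have [bA _ _] := pA.
  by have [lr _] := poly_op_bounded (r n) bA; move=> a x y; rewrite lr lS.
have kerU x : U x = 0 <-> A x = 0.
  have [k [Ak xk /Unrm Ux]] := hr x; split=> h.
    by move: Ux; rewrite h nrm0 => /esym /nrm_eq0 /eqP; rewrite subr_eq0 => /eqP ->.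
  apply: nrm_eq0; rewrite Ux (_ : x - k = 0) ?nrm0//.
  by apply/rip_self_eq0/inner0_rip/xk; rewrite linB// h Ak subrr.
exists U; split.
- apply/bounded_opP; split=> //; exists 1 => // x; have [k [Ak xk /Unrm ->]] := hr x.
  by rewrite mul1r ortho_nrm_le//; apply/inner0_rip/xk.
- move=> x hx; have [k [Ak xk /Unrm Ux]] := hr x; rewrite !normE Ux.
  rewrite (_ : k = 0) ?subr0//; apply: rip_self_eq0.
  have /kerU/hx/inner0_rip xk0 := Ak; have := inner0_rip (xk _ Ak).
  by rewrite ripDl ripNl xk0 sub0r => /eqP; rewrite oppr_eq0 => /eqP.
- by move=> x; rewrite kerU.
(* A x has no component in ker A, so A (r_n(A) (A x)) tends to A x; as |S y| = |A y|, S (r_n(A) (A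
   x)) tends to S x, which is therefore U (A x). *)
apply/funext => x /=; have [k [Ak xk Alim]] := hr (A x).
have k0 : k = 0.
  apply: rip_self_eq0; have := inner0_rip (xk _ Ak).
  by rewrite ripDl ripNl selfadj_rip// Ak rip0r sub0r => /eqP; rewrite oppr_eq0 => /eqP.
rewrite k0 subr0 in Alim; apply: tends_uniq (hU (A x)).
apply: tends_squeeze Alim => n.
by rewrite -(linB lS) -AS (linB lA).
Qed.

Lemma polarP : [/\ bounded_op (polar_part S), partial_isometry (polar_part S),
  (forall x, polar_part S x = 0 <-> S x = 0) & S = polar_part S \o A].
Proof. exact: (xgetPex _ polar_exists). Qed.

Let U := polar_part S.
Let bU : bounded_op U. Proof. by case: polarP. Qed.
Let V := adjoint U.

(** U^* U is the projection removing the component k of x in ker |S| = ker U; this handles the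
    convention for |S|^0. *)
Lemma polar_initial x : exists k,
  [/\ A k = 0, U k = 0, nrm (U x) = nrm (x - k), nrm (x - k) <= nrm x & V (U x) = x - k].
Proof.
have [_ isoU kerU SU] := polarP; have [r hr] := ker_decomposition pA.
have decomp z : exists k, [/\ A k = 0, U k = 0, nrm (U z) = nrm (z - k) & nrm (z - k) <= nrm z].
  have [k [Ak zk _]] := hr z; exists k; have Uk : U k = 0 by apply/kerU/kerAS.
  split=> //; last by apply/ortho_nrm_le/inner0_rip/zk.
  rewrite -[nrm (z - k)]/(complex.Re `|z - k|) -(isoU (z - k)).
    by rewrite -/U (linB (bounded_op_lin bU)) Uk subr0.
  by move=> y /kerU/kerAS; apply: zk.
have [k [Ak Uk Ux xk]] := decomp x; exists k; split=> //.
(* [|U^* U x - (x - k)|^2 <= 0], because [|U^*| <= 1] and [|U x| = |x - k|] *)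
have UxE : U x = U (x - k) by rewrite (linB (bounded_op_lin bU)) Uk subr0.
have U1 : bnd 1 U by move=> z; have [k' [_ _ -> hz]] := decomp z; rewrite mul1r.
have V1 := adjoint_bnd bU ler01 U1.
apply/eqP; rewrite -subr_eq0; apply/eqP/nrm_eq0/eqP.
rewrite -sqrf_eq0 eq_le sqr_ge0 andbT nrmB_sqr -adjoint_ripr// -UxE rip_nrm Ux.
have := V1 (U x); rewrite mul1r Ux -(ler_pXn2r (n := 2)) ?nnegrE ?nrm_ge0//.
by rewrite -/V; lra.
Qed.

Lemma polar_bnd : bnd 1 U.
Proof. by move=> x; have [k [_ _ -> h _]] := polar_initial x; rewrite mul1r. Qed.

Let h01 s : 0 <= s <= 1 -> s != 0 -> 0 < s <= 1.
Proof. by move=> /andP[s0 ->] sn; rewrite andbT lt_neqAle eq_sym sn. Qed.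

Lemma abs_pow_bounded s : 0 <= s <= 1 -> bounded_op (abs_pow S s).
Proof.
rewrite /abs_pow; have [_ _|sn hs] := eqVneq s 0; last exact: op_pow_bounded (h01 hs sn).
by apply: bounded_op_comp => //; exact: adjoint_bounded.
Qed.

Lemma abs_pow_bnd s : 0 <= s <= 1 -> bnd (opnorm S `^ s) (abs_pow S s).
Proof.
rewrite /abs_pow; have [-> _ x|sn hs x] := eqVneq s 0.
  rewrite powRr0 mul1r /=; have [k [_ _ _ h]] := polar_initial x.
  by rewrite -/U -/V => ->.
apply: (le_trans (op_pow_bnd pA (h01 hs sn) x)); rewrite ler_wpM2r ?nrm_ge0//.
case/andP: hs => s0 _; apply: ge0_ler_powR => //; rewrite ?nnegrE ?opnorm_ge0//.
exact: opnorm_op_abs.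
Qed.

(** For 0 < t < 1 this is the law of exponents. At an endpoint one power is U^* U, which only
    removes a vector of ker |S| = ker U, and a neighbouring factor annihilates that vector anyway:
    |S| for t = 0, U for t = 1. *)
Lemma polar_abs_pow t x : 0 <= t <= 1 -> S x = U (abs_pow S (1 - t) (abs_pow S t x)).
Proof.
move=> ht; have [_ _ _ SU] := polarP.
have Sx z : S z = U (A z) by have := congr1 (fun f => f z) SU.
have [t0|t0] := eqVneq t 0.
  rewrite t0 subr0 /abs_pow eqxx oner_eq0 op_pow1// /= Sx -/U -/V.
  have [k [Ak _ _ _ ->]] := polar_initial x.
  by rewrite -/A (linB lA) Ak subr0.
have [t1|t1] := eqVneq (1 - t) 0.
  have -> : t = 1 by move/eqP: t1; rewrite subr_eq0 => /eqP.
  rewrite subrr /abs_pow eqxx oner_eq0 op_pow1// /= -/A Sx -/U -/V.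
  have [k [_ Uk _ _ ->]] := polar_initial (A x).
  by rewrite (linB (bounded_op_lin bU)) Uk subr0.
rewrite /abs_pow (negbTE t0) (negbTE t1) -/A Sx; congr (U _).
have ht' : 0 < 1 - t <= 1.
  by apply: h01 t1; move: ht => /andP[? ?]; apply/andP; split; lra.
have := congr1 (fun f => f x) (op_powD pA ht' (h01 ht t0) _).
by rewrite /= subrK op_pow1// => ->.
Qed.

End Polar.

Lemma aluthge_bounded t S : 0 <= t <= 1 -> bounded_op S -> bounded_op (aluthge t S).
Proof.
move=> ht bS; have ht' : 0 <= 1 - t <= 1.
  by move: ht => /andP[? ?]; apply/andP; split; lra.
apply: bounded_op_comp; last exact: abs_pow_bounded.
by apply: bounded_op_comp; [exact: abs_pow_bounded|case: (polarP bS)].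
Qed.

(** The three factors contribute ||S||^t, 1 and ||S||^(1-t). *)
Lemma opnorm_aluthge t S : 0 <= t <= 1 -> bounded_op S ->
  opnorm (aluthge t S) <= opnorm S.
Proof.
move=> ht bS; have ht' : 0 <= 1 - t <= 1.
  by move: ht => /andP[? ?]; apply/andP; split; lra.
apply: opnorm_le; first exact: opnorm_ge0.
move=> x; rewrite /aluthge /=.
apply: (le_trans (abs_pow_bnd bS ht _)).
apply: (le_trans (ler_wpM2l (powR_ge0 _ _) (polar_bnd bS _))); rewrite mul1r.
apply: (le_trans (ler_wpM2l (powR_ge0 _ _) (abs_pow_bnd bS ht' _))).
rewrite mulrA -powRD; last by rewrite subrKC oner_eq0.
by rewrite subrKC powRr1 ?opnorm_ge0.
Qed.

End PolarDecomposition.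

(** * Numerical radius *)

Section NumericalRadius.
Context {R : realType} {H : hilbertType R}.
Implicit Types (S T Y Z : H -> H) (x y v : H) (t : R).

(* [w^2 - T^2 = (w - T) (w + T) = (w + T) (w - T)], and [2 w v] is the sum of
   [(w + T) v] and [(w - T) v]. *)
Lemma rip_sqr_le T (w : R) v : bounded_op T -> 0 < w ->
  (forall x, `|rip (T x) x| <= w * nrm x ^+ 2) -> rip (T (T v)) v <= w ^+ 2 * nrm v ^+ 2.
Proof.
move=> bT w0 hT; have lT := bounded_op_lin bT.
pose y1 := w%:C *: v + T v; pose y2 := w%:C *: v - T v.
have := hT y1; have := hT y2; rewrite !ler_norml => /andP[h2 _] /andP[_ h1].
have e1 : 0 <= rip (w%:C *: y1 - T y1) y1.
  by rewrite ripDl ripNl ripZl rip_nrm subr_ge0.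
have e2 : 0 <= rip (w%:C *: y2 + T y2) y2.
  by rewrite ripDl ripZl rip_nrm; lra.
have TT1 : w%:C *: y1 - T y1 = (w ^+ 2)%:C *: v - T (T v).
  rewrite /y1 (linD lT) (linZ lT) scalerDr scalerA -rmorphM -expr2.
  by rewrite opprD addrA addrK.
have TT2 : w%:C *: y2 + T y2 = (w ^+ 2)%:C *: v - T (T v).
  rewrite /y2 (linB lT) (linZ lT) scalerBr scalerA -rmorphM -expr2.
  by rewrite addrA subrK.
have : 0 <= rip ((w ^+ 2)%:C *: v - T (T v)) (y1 + y2).
  by rewrite ripDr -{1}TT1 -TT2 addr_ge0.
have -> : y1 + y2 = (2 * w)%:C *: v.
  by rewrite /y1 /y2 addrACA subrr addr0 -scalerDl -rmorphD mulrDl mul1r.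
by rewrite ripZr pmulr_rge0 ?mulr_gt0// ripDl ripNl ripZl rip_nrm subr_ge0.
Qed.

(** [rip_sqr_le] is applied to c T, whose square is c^2 T^2 and for which |<c T x, x>| = |<T x, x>|.
    It asks for a positive bound while w(T) may be 0, so w(T) + e is used and e tends to 0. *)
Lemma num_radius_sqr_le T (c : R[i]) v : bounded_op T -> cmod c = 1 ->
  rip ((c * c) *: T (T v)) v <= num_radius T ^+ 2 * nrm v ^+ 2.
Proof.
move=> bT c1; have lT := bounded_op_lin bT; set w := num_radius T.
have w0 : 0 <= w := num_radius_ge0 T.
have bcT := bounded_opZ c bT.
rewrite -subr_le0; apply: (@le_eps_lin _ _ ((2 * w + 1) * nrm v ^+ 2)) => e /andP[e0 e1].
have we : 0 < w + e by rewrite ltr_wpDl.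
have := @rip_sqr_le (fun x => c *: T x) (w + e) v bcT we.
rewrite /= (linZ lT) scalerA => h.
have {}h : rip ((c * c) *: T (T v)) v <= (w + e) ^+ 2 * nrm v ^+ 2.
  apply: h => x; rewrite /rip innerZl.
  rewrite (le_trans (norm_Re_le_cmod _))// cmodM c1 mul1r.
  rewrite (le_trans (num_radius_ub _ bT))// ler_wpM2r ?sqr_ge0// lerDl ltW//.
rewrite lerBlDl (le_trans h)//.
have -> : w ^+ 2 * nrm v ^+ 2 + (2 * w + 1) * nrm v ^+ 2 * e =
    (w ^+ 2 + (2 * w + 1) * e) * nrm v ^+ 2 by ring.
by rewrite ler_wpM2r ?sqr_ge0//; nra.
Qed.

(* Polarization bounds [4 Re <Y Z x, x> = 4 Re <Z x, Y^* x>] by [|K x|^2] with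
   [K = s Z + Y^* / s]; then [||K|| = ||K^*||] reverses the order of the factors,
   and [s^2 = y / z] balances the two norms. *)
Lemma rip_comp_le Y Z (y z w : R) x : bounded_op Y -> bounded_op Z ->
  0 <= y -> 0 <= z -> 0 <= w -> bnd y Y -> bnd z Z ->
  (forall v, rip (Z (Y v)) v <= w * nrm v ^+ 2) ->
  2 * rip (Y (Z x)) x <= (y * z + w) * nrm x ^+ 2.
Proof.
move=> bY bZ yge0 zge0 w0 hY hZ hZY.
(* Here no s balances the two norms, but Cauchy-Schwarz already gives Re <Y Z x, x> <= y z |x|^2 =
   0. *)
have [yz0|yz_neq0] := eqVneq (y * z) 0.
  have : rip (Y (Z x)) x <= y * z * nrm x * nrm x.
    rewrite (le_trans (rip_le _ _))// ler_wpM2r ?nrm_ge0// (le_trans (hY _))//.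
    by rewrite -mulrA ler_wpM2l.
  have : 0 <= w * nrm x ^+ 2 by rewrite mulr_ge0 ?sqr_ge0.
  by rewrite yz0 !mul0r add0r => *; lra.
move: yz_neq0; rewrite mulf_eq0 negb_or => /andP[y_neq0 z_neq0].
have y0 : 0 < y by rewrite lt_neqAle eq_sym y_neq0.
have z0 : 0 < z by rewrite lt_neqAle eq_sym z_neq0.
have lY := bounded_op_lin bY; have lZ := bounded_op_lin bZ.
pose s := Num.sqrt (y / z); have s0 : 0 < s by rewrite sqrtr_gt0 divr_gt0.
have s2 : s ^+ 2 = y / z by rewrite sqr_sqrtr// divr_ge0// ltW.
pose K v := s%:C *: Z v + s^-1%:C *: adjoint Y v.
pose K' v := s%:C *: adjoint Z v + s^-1%:C *: Y v.
pose kappa := 2 * (y * z + w).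
have adjK u v : rip (K u) v = rip u (K' v).
  by rewrite /K /K' !ripE adjoint_rip// -adjoint_ripr.
have hZ' := adjoint_bnd bZ (ltW z0) hZ.
have K'v v : nrm (K' v) ^+ 2 <= kappa * nrm v ^+ 2.
  rewrite /K' nrmD_sqr !nrmZr !exprMn !ger0_norm ?invr_ge0 ?(ltW s0)// exprVn s2 ripZl ripZr.
  rewrite -adjoint_ripr// (ripC v).
  have h1 : nrm (adjoint Z v) ^+ 2 <= z ^+ 2 * nrm v ^+ 2.
    by rewrite -exprMn ler_pXn2r ?nnegrE ?mulr_ge0 ?nrm_ge0 ?(ltW z0).
  have h2 : nrm (Y v) ^+ 2 <= y ^+ 2 * nrm v ^+ 2.
    by rewrite -exprMn ler_pXn2r ?nnegrE ?mulr_ge0 ?nrm_ge0 ?(ltW y0).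
  have h3 := hZY v.
  have h4 : y / z * nrm (adjoint Z v) ^+ 2 <= y * z * nrm v ^+ 2.
    rewrite (_ : y * z * _ = y / z * (z ^+ 2 * nrm v ^+ 2)); last first.
      by field; rewrite gt_eqF.
    by rewrite ler_wpM2l// divr_ge0// ltW.
  have h5 : (y / z)^-1 * nrm (Y v) ^+ 2 <= y * z * nrm v ^+ 2.
    rewrite (_ : y * z * _ = (y / z)^-1 * (y ^+ 2 * nrm v ^+ 2)); last first.
      by field; rewrite !gt_eqF.
    by rewrite ler_wpM2l// invr_ge0 divr_ge0// ltW.
  have -> : s * (s^-1 * rip (Z (Y v)) v) = rip (Z (Y v)) v by field; rewrite gt_eqF.
  by rewrite /kappa; lra.
have kn v : 0 <= kappa * nrm v ^+ 2 := le_trans (sqr_ge0 _) (K'v v).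
have Kx : nrm (K x) ^+ 2 <= kappa * nrm x ^+ 2.
  have [k0|k0] := ltP 0 (nrm (K x)); last first.
    have -> : nrm (K x) = 0 by apply/le_anti; rewrite k0 nrm_ge0.
    by rewrite expr0n.
  have h : nrm (K x) ^+ 2 <= nrm x * nrm (K' (K x)) by rewrite -rip_nrm adjK rip_le.
  have := K'v (K x); move: h; move: (nrm_ge0 (K' (K x))) k0 (nrm_ge0 x).
  move: (nrm (K x)) (nrm (K' (K x))) (nrm x) => a b c b0 a0 c0 ab bk.
  (* From a^2 <= c b and b^2 <= kappa a^2 follows a^4 <= kappa c^2 a^2, and a^2 cancels. *)
  have h2 : (a ^+ 2) ^+ 2 <= c ^+ 2 * b ^+ 2.
    by rewrite -exprMn ler_pXn2r ?nnegrE ?sqr_ge0 ?mulr_ge0.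
  rewrite -(ler_pM2r (exprn_gt0 2 a0)) -expr2 (le_trans h2)//.
  have -> : kappa * c ^+ 2 * a ^+ 2 = c ^+ 2 * (kappa * a ^+ 2) by ring.
  by rewrite ler_wpM2l ?sqr_ge0.
have : 4 * rip (Y (Z x)) x <= nrm (K x) ^+ 2.
  have := sqr_ge0 (nrm (s%:C *: Z x - s^-1%:C *: adjoint Y x)).
  rewrite nrmB_sqr /K nrmD_sqr ripZl ripZr (adjoint_rip _ _ bY).
  have -> : s * (s^-1 * rip (Z x) (adjoint Y x)) = rip (Z x) (adjoint Y x).
    by field; rewrite gt_eqF.
  by lra.
by move: Kx; rewrite /kappa; lra.
Qed.

(* With [T = U W Z] and [Z U W = T1], where [W = |T|^(1-t)] and [Z = |T|^t], one has
   [T^2 = Y Z] and [Z Y = T1^2] for [Y = U W T1]. *)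
Lemma num_radius_aluthge T t : 0 <= t <= 1 -> bounded_op T ->
  num_radius T ^+ 2 <=
  4^-1 * (opnorm T * opnorm (aluthge t T) +
          opnorm (fun x => adjoint T (T x) + T (adjoint T x)))
  + 4^-1 * num_radius (aluthge t T) ^+ 2.
Proof.
move=> ht bT; have lT := bounded_op_lin bT.
have ht' : 0 <= 1 - t <= 1.
  by move: ht => /andP[? ?]; apply/andP; split; lra.
set N := opnorm (fun x => adjoint T (T x) + T (adjoint T x)); set T1 := aluthge t T.
have bT1 : bounded_op T1 by apply: aluthge_bounded.
have lT1 := bounded_op_lin bT1.
have bA := adjoint_bounded bT.
have bN : bounded_op (fun x => adjoint T (T x) + T (adjoint T x)).
  by apply: bounded_opD; apply: bounded_op_comp.
set rhs := (X in _ <= X).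
have rhs0 : 0 <= rhs.
  apply: addr_ge0; apply: mulr_ge0; rewrite ?invr_ge0// ?sqr_ge0//.
  by apply: addr_ge0; [apply: mulr_ge0|]; apply: opnorm_ge0.
rewrite -[leRHS]sqr_sqrtr// ler_pXn2r ?nnegrE ?sqrtr_ge0 ?num_radius_ge0//.
apply: num_radius_le; first exact: sqrtr_ge0.
move=> x x1; rewrite -(ler_pXn2r (n := 2)) ?nnegrE ?sqrtr_ge0 ?cmod_ge0// sqr_sqrtr//.
have [c c1 <-] := cmod_rot (inner (T x) x).
rewrite -innerZl -/(rip _ _).
have h1 : (2 * rip (c *: T x) x) ^+ 2 <= nrm (c *: T x + c^*%C *: adjoint T x) ^+ 2.
  have -> : 2 * rip (c *: T x) x = rip (c *: T x + c^*%C *: adjoint T x) x.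
    have [_ hA] := adjointP bT.
    rewrite ripDl mulrDl mul1r; congr (_ + _).
    by rewrite /rip !innerZl (innerC (adjoint T x)) -hA -rmorphM ReJ.
  rewrite -[leLHS]real_normK ?num_real// ler_pXn2r ?nnegrE ?nrm_ge0//.
  by rewrite (le_trans (norm_rip_le _ _))// x1 mulr1.
(* The cross term is 2 Re <c T x, conj(c) T^* x> = 2 Re (c^2 <T^2 x, x>). *)
have h2 : nrm (c *: T x + c^*%C *: adjoint T x) ^+ 2 =
    rip (adjoint T (T x) + T (adjoint T x)) x + 2 * rip ((c * c) *: T (T x)) x.
  have [_ hA] := adjointP bT.
  rewrite nrmD_sqr !nrmZ cmodJ c1 !mul1r -!rip_nrm ripDl.
  have -> : rip (adjoint T (T x)) x = rip (T x) (T x) by rewrite adjoint_ripr.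
  have -> : rip (T (adjoint T x)) x = rip (adjoint T x) (adjoint T x).
    by rewrite (adjoint_rip _ _ bT).
  have -> : rip (c *: T x) (c^*%C *: adjoint T x) = rip ((c * c) *: T (T x)) x.
    by rewrite /rip !innerZl innerZr conjcK mulrA -hA.
  by rewrite addrAC.
set U := polar_part T; set W := abs_pow T (1 - t); set Z := abs_pow T t.
have [bU _ _ _] := polarP bT; rewrite -/U in bU.
have bW : bounded_op W by apply: abs_pow_bounded.
have bZ : bounded_op Z by apply: abs_pow_bounded.
have lU := bounded_op_lin bU; have lW := bounded_op_lin bW; have lZ := bounded_op_lin bZ.
(* With the phase inside Y, Y Z = c^2 T^2 and Z Y = c^2 T1^2, the form treated by
   [num_radius_sqr_le]. *)
pose Y v := (c * c) *: (U \o W \o T1) v.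
have bY : bounded_op Y.
  by apply: bounded_opZ; apply: bounded_op_comp => //; apply: bounded_op_comp.
have TE v : T v = U (W (Z v)) by apply: polar_abs_pow.
have YZ : Y (Z x) = (c * c) *: T (T x) by rewrite /Y/= [T x]TE TE.
pose y := opnorm T `^ (1 - t) * opnorm T1; pose z := opnorm T `^ t.
have yz : y * z = opnorm T * opnorm T1.
  rewrite /y /z mulrAC -powRD ?subrK ?oner_eq0// powRr1 ?opnorm_ge0//.
have hY : bnd y Y.
  move=> v; rewrite /Y nrmZ cmodM c1 !mul1r /y -mulrA.
  apply: (le_trans (polar_bnd bT _)); rewrite mul1r.
  apply: (le_trans (abs_pow_bnd bT ht' _)); rewrite ler_wpM2l ?powR_ge0//.
  exact: opnorm_bnd.
have hZ : bnd z Z := abs_pow_bnd bT ht.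
have := @rip_comp_le Y Z y z (num_radius T1 ^+ 2) x bY bZ.
rewrite YZ yz x1 expr1n mulr1 => h3.
have {}h3 : 2 * rip ((c * c) *: T (T x)) x <= opnorm T * opnorm T1 + num_radius T1 ^+ 2.
  apply: h3 => //; [|exact: powR_ge0|exact: sqr_ge0|].
    by rewrite mulr_ge0 ?powR_ge0 ?opnorm_ge0.
  by move=> v; rewrite /Y (linZ lZ); apply: num_radius_sqr_le.
have h4 : rip (adjoint T (T x) + T (adjoint T x)) x <= N.
  rewrite (le_trans (rip_le _ _))// x1 mulr1.
  by have := opnorm_bnd bN x; rewrite x1 mulr1.
move: h1; rewrite h2 exprMn /rhs => h1.
by lra.
Qed.

(** * Iteration of the one-step inequality *)

Lemma num_radius_le_opnorm T : bounded_op T -> num_radius T <= opnorm T.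
Proof.
move=> bT; apply: num_radius_le; first exact: opnorm_ge0.
move=> x x1; rewrite (le_trans (cmod_inner_le _ _))// x1 mulr1.
by have := opnorm_bnd bT x; rewrite x1 mulr1.
Qed.

Lemma iter_aluthge_bounded t T n : 0 <= t <= 1 -> bounded_op T ->
  bounded_op (iter_aluthge t T n).
Proof.
by move=> ht bT; elim: n => //= n IH; apply: aluthge_bounded.
Qed.

Lemma opnorm_iter_aluthge t T n : 0 <= t <= 1 -> bounded_op T ->
  opnorm (iter_aluthge t T n) <= opnorm T.
Proof.
move=> ht bT; elim: n => //= n IH.
by rewrite (le_trans (opnorm_aluthge ht (iter_aluthge_bounded n ht bT))).
Qed.

(** The summand of index n + 1 of the series, without its weight 4^-(n+1). *)
Definition aluthge_term t T n : R :=
  opnorm (iter_aluthge t T n) * opnorm (iter_aluthge t T n.+1) +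
  opnorm (fun x => adjoint (iter_aluthge t T n) (iter_aluthge t T n x) +
                   iter_aluthge t T n (adjoint (iter_aluthge t T n) x)).

Lemma num_radius_partial_sum t T N : 0 <= t <= 1 -> bounded_op T ->
  num_radius T ^+ 2 <= \sum_(1 <= n < N.+1) 4 ^- n * aluthge_term t T n.-1
                       + 4 ^- N * num_radius (iter_aluthge t T N) ^+ 2.
Proof.
move=> ht bT; elim: N => [|N IH].
  by rewrite big_geq// add0r expr0 invr1 mul1r.
apply: (le_trans IH); rewrite [in leRHS]big_nat_recr//= -addrA lerD2l.
have := num_radius_aluthge ht (iter_aluthge_bounded N ht bT).
have -> : 4 ^- N.+1 = 4 ^- N * 4^-1 :> R by rewrite exprSr invfM.
have p : 0 <= 4 ^- N :> R by rewrite invr_ge0 exprn_ge0.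
move/(ler_wpM2l p); rewrite mulrDr !mulrA; exact.
Qed.

End NumericalRadius.

Theorem theorem2p12 (R : realType) (H : hilbertType R) (T : H -> H)
    (hT : bounded_op T) (t : R) (ht : 0 <= t <= 1) :
  ((num_radius T ^+ 2)%:E <=
   \sum_(1 <= n <oo)
     (4 ^- n *
      (opnorm (iter_aluthge t T n.-1) * opnorm (iter_aluthge t T n) +
       opnorm (fun x : H =>
         adjoint (iter_aluthge t T n.-1) (iter_aluthge t T n.-1 x) +
         iter_aluthge t T n.-1 (adjoint (iter_aluthge t T n.-1) x))))%:E)%E.
Proof.
set F := (F in (\sum_(1 <= n <oo) F n)%E).
have F0 n : (0 <= F n)%E.
  rewrite lee_fin mulr_ge0 ?invr_ge0 ?exprn_ge0//.
  by rewrite addr_ge0 ?mulr_ge0 ?opnorm_ge0.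
have partial N : (\sum_(1 <= n < N.+1) F n)%E =
    (\sum_(1 <= n < N.+1) 4 ^- n * aluthge_term t T n.-1)%:E.
  rewrite -sumEFin; apply: eq_big_nat => n /andP[n1 _].
  by rewrite /F /aluthge_term prednK.
have partial_le N : (\sum_(1 <= n < N.+1) F n <= \sum_(1 <= n <oo) F n)%E.
  exact: nneseries_lim_ge.
apply/lee_addgt0Pr => e e0.
(* The remainder after N steps is at most 4^-N ||T||^2; any N >= ||T||^2 / e will do, because N <=
   4^N. *)
have [N hN] : exists N, 4 ^- N * opnorm T ^+ 2 <= e.
  exists (Num.bound (opnorm T ^+ 2 / e)).
  rewrite mulrC ler_pdivrMr ?exprn_gt0// mulrC -ler_pdivrMr//.
  have := archi_boundP (divr_ge0 (sqr_ge0 (opnorm T)) (ltW e0)).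
  move/ltW/le_trans; apply; rewrite -natrX ler_nat ltnW// ltn_expl//.
apply: (@le_trans _ _ ((\sum_(1 <= n < N.+1) F n) + e%:E)%E); last by rewrite leeD2r.
rewrite partial -EFinD lee_fin (le_trans (num_radius_partial_sum N ht hT))// lerD2l.
apply: le_trans hN; rewrite ler_wpM2l ?invr_ge0 ?exprn_ge0//.
rewrite ler_pXn2r ?nnegrE ?num_radius_ge0 ?opnorm_ge0//.
apply: le_trans (opnorm_iter_aluthge N ht hT).
by apply: num_radius_le_opnorm; apply: iter_aluthge_bounded.
Qed.
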